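(* Suppose that $\lambda$ is bounded on $[t_0,+\infty)$, $\alpha>3$, $b(t_0)\ge\frac12+\frac{\beta}{t_0}$, and that $$(\alpha-3)\,t\,b(t)-t^2\dot b(t)+\beta(2-\alpha)\ \ge\ 0\quad\text{for all } t\ge t_0,$$ $$\text{there exists } a\ge1 \text{ such that } 2\dot\varepsilon(t)\ \le\ -a\beta\varepsilon^2(t)\quad\text{for all } t\ge t_0,$$ $$\int_{t_0}^{+\infty}\frac{\varepsilon(t)}{t\,b(t)}\,dt<+\infty.$$ Suppose additionally that for all $t\ge t_0$ $$\left(\frac{\alpha}{3}-1\right)t\,b(t)-t^2\dot b(t)+\frac{\alpha\beta}{3}\ \ge\ 0,$$ $$2\alpha(\alpha-3)-9t^2\varepsilon(t)+6\alpha\beta\ \le\ 0,$$ $$18\beta t+9\beta\dot\lambda(t)-9t\,b(t)\left(\dot\lambda(t)+2\beta\right)+3(\alpha+3)\beta^2+\alpha^2\beta\ \le\ 0,$$ and that $$\lim_{t\to+\infty}\frac{\beta}{t^{\frac{\alpha}{3}+1}\varepsilon(t)}\int_{t_0}^{t}s^{\frac{\alpha}{3}+1}\varepsilon^2(s)\,ds=0.$$ Let $x:[t_0,+\infty)\to H$ be a solution of $$\ddot x(t)+\frac{\alpha}{t}\dot x(t)+\beta\frac{d}{dt}\nabla\Phi_{\lambda(t)}(x(t))+b(t)\nabla\Phi_{\lambda(t)}(x(t))+\varepsilon(t)x(t)=0,\qquad t\ge t_0,$$ and let $x^*=\mathrm{proj}_{\operatorname{argmin}\Phi}(0)$. If the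 trajectory stays either inside the ball $B(0,\|x^*\|)$ (that is, $\|x(t)\|<\|x^*\|$ for all $t\ge t_0$) or outside it (that is, $\|x(t)\|\ge\|x^*\|$ for all $t\ge t_0$), then $x(t)$ converges strongly to the minimal norm solution $x^*$ as $t\to+\infty$. Otherwise, $\liminf_{t\to+\infty}\|x(t)-x^*\|=0$.
   Context: $H$ is a real Hilbert space with inner product $\langle\cdot,\cdot\rangle$ and norm $\|\cdot\|$. $\Phi:H\to\mathbb{R}\cup\{\pm\infty\}$ is proper, convex and lower semicontinuous with nonempty set of global minimizers $\operatorname{argmin}\Phi$; $\mathrm{proj}_{\operatorname{argmin}\Phi}(0)$ is the minimal norm element of $\operatorname{argmin}\Phi$. For $\lambda>0$ the Moreau envelope is $\Phi_\lambda(x)=\inf_{y\in H}\{\Phi(y)+\frac{1}{2\lambda}\|x-y\|^2\}$, a convex continuously differentiable function with $\nabla\Phi_\lambda$ being $\frac1\lambda$-Lipschitz. Standing assumptions: $\alpha,\beta,t_0>0$; $\lambda:[t_0,+\infty)\to(0,+\infty)$ and $b:[t_0,+\infty)\to[0,+\infty)$ are non-decreasing and differentiable; $\varepsilon:[t_0,+\infty)\to[0,+\infty)$ is continuously differentiable and non-increasing with $\lim_{t\to+\infty}\varepsilon(t)=0$. A solution is a strong global solution: $x$ is continuously differentiable with $\dot x$ locally absolutely continuous, satisfies the equation for almost every $t\ge t_0$, and has some initial data $x(t_0)=x_0\in H$, $\dot x(t_0)=\dot x_0\in H$. *)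

(* Defs.v *)
From HB Require Import structures.
From mathcomp Require Import all_boot all_order all_algebra.
From mathcomp Require Import sesquilinear.
From mathcomp Require Import all_classical all_reals all_analysis.

Set Implicit Arguments.
Unset Strict Implicit.
Unset Printing Implicit Defensive.

Import Order.TTheory GRing.Theory Num.Theory.
Import numFieldNormedType.Exports.

Local Open Scope classical_set_scope.
Local Open Scope ring_scope.

(* A real Hilbert space is encoded as a [completeNormedModType R] together with
   a positive definite symmetric bilinear form inducing its norm. *)
Definition induces_norm (R : realType) (H : normedModType R)
    (ip : {dot H for idfun}) : Prop :=
  forall v : H, `|v| ^+ 2 = ip v v.

Section half_line_calculus.
Variables (R : realType) (V : normedModType R) (t0 : R).
Implicit Types (f : R -> V) (t : R).

(* The functions of the problem live on [t0, +oo[ only, whereas a term of type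
   [R -> V] is total. All derivatives are hence taken relative to the half-line:
   two-sided at t > t0, one-sided at t0; values at s < t0 are irrelevant. *)
Definition half_line_slope f t (s : R) : V := (s - t)^-1 *: (f s - f t).

Definition punctured_half_line t : set_system R :=
  within [set` `[t0, +oo[] t^'.

Definition hl_derivable f t : Prop :=
  cvg (half_line_slope f t @ punctured_half_line t).

Definition hl_derive f t : V :=
  lim (half_line_slope f t @ punctured_half_line t).

Definition hl_differentiable f : Prop :=
  forall t, t0 <= t -> hl_derivable f t.

Definition hl_C1 f : Prop :=
  hl_differentiable f /\ {within [set` `[t0, +oo[], continuous (hl_derive f)}.

Definition abs_continuous (a b : R) f : Prop :=
  forall e : R, 0 < e -> exists2 d : R, 0 < d &
    forall (n : nat) (u v : 'I_n -> R),
      (forall i, a <= u i /\ u i <= v i /\ v i <= b) ->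
      trivIset [set: 'I_n] (fun i => [set` `]u i, v i[]) ->
      \sum_(i < n) (v i - u i) < d ->
      \sum_(i < n) `|f (v i) - f (u i)| < e.

Definition loc_abs_continuous f : Prop :=
  forall T, t0 <= T -> abs_continuous t0 T f.

End half_line_calculus.

Section convex_analysis.
Variables (R : realType) (H : normedModType R).
Implicit Types (Phi : H -> \bar R) (C : set H).

Definition proper_function Phi : Prop :=
  (forall x, Phi x != -oo%E) /\ (exists x, Phi x != +oo%E).

(* Used for functions that never take the value -oo, so that the right-hand side
   is never of the form oo - oo; note that 0 * +oo = 0. *)
Definition econvex Phi : Prop :=
  forall (x y : H) (s : R), 0 <= s <= 1 ->
    (Phi (s *: x + (1 - s) *: y)%R <= s%:E * Phi x + (1 - s)%R%:E * Phi y)%E.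

Definition argmin Phi : set H := [set x | forall y, (Phi x <= Phi y)%E].

Definition is_metric_proj C (z p : H) : Prop :=
  C p /\ forall c, C c -> `|z - p| <= `|z - c|.

Definition metric_proj C (z : H) : H := xget 0 [set p | is_metric_proj C z p].

Definition moreau Phi (lam : R) (x : H) : \bar R :=
  ereal_inf [set (Phi y + ((2 * lam)^-1 * `|x - y| ^+ 2)%R%:E)%E | y in [set: H]].

Definition is_gradient (ip : {dot H for idfun}) (f : H -> R) (x g : H) : Prop :=
  differentiable f x /\ forall h : H, 'd f x h = ip g h.

Definition gradient (ip : {dot H for idfun}) (f : H -> R) (x : H) : H :=
  xget 0 [set g | is_gradient ip f x g].

(* For Phi proper, convex, lsc and lam > 0 the envelope is finite everywhere, so
   [fine] loses nothing. *)
Definition grad_moreau (ip : {dot H for idfun}) Phi (lam : R) : H -> H :=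
  gradient ip (fun y => fine (moreau Phi lam y)).

End convex_analysis.

Section dynamics.
Variables (R : realType) (H : normedModType R) (ip : {dot H for idfun}).
Variables (Phi : H -> \bar R) (alpha beta t0 : R) (lam b eps : R -> R).

Definition grad_along (x : R -> H) (t : R) : H :=
  grad_moreau ip Phi (lam t) (x t).

Definition strong_global_solution (x0 v0 : H) (x : R -> H) : Prop :=
  [/\ hl_C1 t0 x,
      loc_abs_continuous t0 (hl_derive t0 x),
      {ae @lebesgue_measure R, forall t, t0 <= t ->
        [/\ hl_derivable t0 (hl_derive t0 x) t,
            hl_derivable t0 (grad_along x) t &
            hl_derive t0 (hl_derive t0 x) t
            + (alpha / t) *: hl_derive t0 x t
            + beta *: hl_derive t0 (grad_along x) t
            + b t *: grad_along x t
            + eps t *: x t = 0]},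
      x t0 = x0 &
      hl_derive t0 x t0 = v0].

End dynamics.

(* Main.v *)
Require Import Defs.
From HB Require Import structures.
From mathcomp Require Import all_boot all_order all_algebra.
From mathcomp Require Import sesquilinear.
From mathcomp Require Import all_classical all_reals all_analysis.
From mathcomp Require Import measurable_realfun ring lra.

Set Implicit Arguments.
Unset Strict Implicit.
Unset Printing Implicit Defensive.

Import Order.TTheory GRing.Theory Num.Theory.
Import numFieldNormedType.Exports.

Local Open Scope classical_set_scope.
Local Open Scope ring_scope.

(** Write z for the minimal norm minimizer of Phi, f(t) >= 0 for the gap between
    the Moreau envelope at x(t) and the minimum of Phi, g(t) for the gradient of
    the envelope at x(t), v for the velocity and w = v + beta g.

    Regularity. The equation reads w' = - (alpha/t) v - b g - eps x almost
    everywhere, and its right-hand side is a continuous function of t. Hence w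
    is differentiable at every t > t0 ([is_derive_velocity]), although v and g
    need not be. The passage from almost everywhere to everywhere uses a mean
    value inequality that tolerates a null set of bad points
    ([mean_value_off_null_set]); it asks v to be absolutely continuous, but the
    remaining terms only to be pointwise Lipschitz, which is all that is known
    of g because lam is merely differentiable. The envelope itself is
    differentiable along the trajectory ([is_derive_envelope_along]), so that
    the energies below have ordinary derivatives and decrease by the usual mean
    value theorem.

    Lyapunov analysis. Both energies have the form
      t (t b - beta) f + t^2 eps/2 (|x|^2 - c) + 1/2 |q (x - z) + t w|^2.
    - The integral condition forces t eps(t) to tend to 0 ([tikhonov_decay]):
      eps is non-increasing, so the integral is at least of order
      t^(alpha/3 + 2) eps(t)^2. For q = alpha - 1 and c = 0 the energy then
      grows at most linearly while it dominates t^2 f/2, so f tends to 0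
      ([value_gap_vanishes]).
    - Take q = 2 alpha/3, c = |z|^2 and multiply by t^(alpha/3 - 1). As long as
      |x| >= |z|, the derivative is at most
      beta/4 |z|^2 t^(alpha/3 + 1) eps^2 ([weighted_energy_bound]); the sign of
      |x|^2 - |z|^2 is what makes the terms in eps' and eps^2 harmless. After
      division by t^(alpha/3 + 1) eps, the integral condition yields
      limsup |x| <= |z| ([limsup_norm_le]).

    Geometry. Points that nearly minimize Phi and whose norm hardly exceeds |z|
    are close to z ([minimal_norm_minimizer]): the midpoint of two of them lies
    in the same convex sublevel set, hence cannot be much shorter than z, and
    the parallelogram identity bounds their distance. Since f tends to 0, the
    proximal points of x(t) nearly minimize Phi and approach x(t), because lam
    is bounded. So x(t) tends to z as soon as limsup |x| <= |z|
    ([cvg_of_limsup_norm]), which is immediate inside the ball and comes from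
    the second energy outside. A trajectory that is not eventually outside has
    |x(t)| < |z| at arbitrarily late times t, and at these times it comes close
    to z. *)

(** * Inner products and nested closed sets *)

Section inner_product.
Variables (R : realType) (H : normedModType R) (ip : {dot H for idfun}).
Hypothesis hip : induces_norm ip.
Implicit Types (u v w : H) (a : R).

Lemma ipC u v : ip u v = ip v u.
Proof. by rewrite (@hermC R false idfun) expr0 mul1r. Qed.

Lemma ipDl u v w : ip (u + v) w = ip u w + ip v w.
Proof. by rewrite linearDl. Qed.

Lemma ipNl u w : ip (- u) w = - ip u w.
Proof. by rewrite linearNl. Qed.

Lemma ipZl a u w : ip (a *: u) w = a * ip u w.
Proof. by rewrite linearZl_LR. Qed.

Lemma ipDr u v w : ip w (u + v) = ip w u + ip w v.
Proof. by rewrite linearDr. Qed.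

Lemma ipNr u w : ip w (- u) = - ip w u.
Proof. by rewrite linearNr. Qed.

Lemma ipZr a u w : ip w (a *: u) = a * ip w u.
Proof. by rewrite linearZr_LR. Qed.

Lemma ip0l w : ip 0 w = 0.
Proof. by rewrite linear0l. Qed.

Lemma ip0r w : ip w 0 = 0.
Proof. by rewrite linear0r. Qed.

Definition ipE := (ipDl, ipNl, ipZl, ipDr, ipNr, ipZr).

Lemma ip_ge0 u : 0 <= ip u u.
Proof. by rewrite -hip exprn_ge0. Qed.

Lemma cauchy_schwarz u v : `|ip u v| <= `|u| * `|v|.
Proof.
have [->|v0] := eqVneq v 0; first by rewrite ipC ip0l normr0 mulr_ge0.
have n0 : 0 < `|v| by rewrite normr_gt0.
rewrite -(@ler_pXn2r _ 2)// ?nnegrE ?mulr_ge0//.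
rewrite exprMn !hip real_normK ?num_real//.
have w0 : 0 < ip v v by rewrite -hip exprn_gt0.
have := ip_ge0 (u - (ip u v / ip v v) *: v).
have -> : ip (u - (ip u v / ip v v) *: v) (u - (ip u v / ip v v) *: v) =
   (ip u u * ip v v - ip u v ^+ 2) / ip v v.
  by rewrite !ipE (ipC v u); field; rewrite gt_eqF.
by rewrite pmulr_lge0 ?invr_gt0// subr_ge0.
Qed.

Lemma ip_le u v : ip u v <= `|u| * `|v|.
Proof. exact: le_trans (ler_norm _) (cauchy_schwarz u v). Qed.

Lemma parallelogram (u v : H) :
  `|u - v| ^+ 2 = 2 * `|u| ^+ 2 + 2 * `|v| ^+ 2 - 4 * `|2^-1 *: (u + v)| ^+ 2.
Proof. by rewrite !hip !ipE (ipC v u); field. Qed.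

(** Besides uniqueness of gradients, this turns an identity between vectors into
    one between real numbers, where [ring] applies. *)
Lemma ip_ext u v : (forall h, ip u h = ip v h) -> u = v.
Proof.
move=> uv; apply/eqP; rewrite -subr_eq0 -normr_eq0 -sqrf_eq0 hip.
by rewrite ipDl ipNl uv subrr.
Qed.

Lemma cvg_ip (T : Type) (F : set_system T) (FF : Filter F) (f g : T -> H) u v :
  f @ F --> u -> g @ F --> v -> ip (f t) (g t) @[t --> F] --> ip u v.
Proof.
move=> fu gv; apply/subr_cvg0; apply: norm_cvg0.
have hf : `|f t - u| @[t --> F] --> (0 : R).
  by rewrite -(normr0 H); apply: cvg_norm; apply/subr_cvg0.
have hg : `|g t - v| @[t --> F] --> (0 : R).
  by rewrite -(normr0 H); apply: cvg_norm; apply/subr_cvg0.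
apply: (@squeeze_cvgr _ _ _ _ (cst 0)
  (fun t => `|f t - u| * `|v| + `|u| * `|g t - v| + `|f t - u| * `|g t - v|)).
- near=> t; rewrite normr_ge0/=.
  have -> : ip (f t) (g t) - ip u v =
      ip (f t - u) v + ip u (g t - v) + ip (f t - u) (g t - v).
    by rewrite !ipE; ring.
  rewrite (le_trans (ler_normD _ _))// lerD ?cauchy_schwarz//.
  by rewrite (le_trans (ler_normD _ _))// lerD ?cauchy_schwarz.
- exact: cvg_cst.
- have -> : 0 = 0 * `|v| + `|u| * 0 + 0 * 0 :> R by rewrite !(mul0r,mulr0,addr0).
  by apply: cvgD; [apply: cvgD; apply: cvgM => //; exact: cvg_cst|exact: cvgM].
Unshelve. all: by end_near.
Qed.

End inner_product.

Section cantor.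
Variables (R : realType) (V : completeNormedModType R).

(** Cantor's intersection theorem, indexed by positive reals rather than by
    integers: the families in use are approximate solution sets at tolerance d.
    It replaces minimizing sequences in both existence proofs below. *)
Lemma cantor_intersection (S : R -> set V) :
  (forall d e, 0 < d -> d <= e -> S d `<=` S e) ->
  (forall d, 0 < d -> closed (S d)) ->
  (forall d, 0 < d -> S d !=set0) ->
  (forall e, 0 < e -> exists2 d, 0 < d &
     forall y z, S d y -> S d z -> `|y - z| < e) ->
  exists z, forall d, 0 < d -> S d z.
Proof.
move=> Smono Scl S0 Sdiam.
pose F := filter_from [set d : R | 0 < d] S.
have FF : ProperFilter F.
  apply: filter_from_proper; last by move=> d /S0.
  apply: filter_from_filter; first by exists 1; exact: ltr01.
  move=> d e /= d0 e0; exists (Num.min d e); first by rewrite /= lt_min d0.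
  move=> y Sy; split; apply: (Smono _ _ _ _ y Sy);
    by rewrite ?lt_min ?d0 ?e0// ge_min lexx// orbT.
have Fc : cauchy F.
  apply: cauchy_exP => e e0; have [d d0 Sd] := Sdiam e e0.
  have [y Sy] := S0 d d0; exists y; exists d => // z Sz.
  by rewrite -ball_normE /=; exact: Sd.
exists (lim F) => d d0; have /cauchy_cvgP Fl := Fc.
apply: (@closed_cvg _ _ F _ id (S d) (Scl d d0)) Fl.
by exists d.
Qed.

End cantor.

(** * Gradients from quadratic error bounds *)

Section gradient_criterion.
Variables (R : realType) (H : normedModType R) (ip : {dot H for idfun}).
Hypothesis hip : induces_norm ip.

(** The functional [ip g] under a name of its own, so that it can carry the
    linear structure with respect to the scaling of R over itself that
    differentials expect. *)
Definition riesz (g h : H) : R := ip g h.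

Lemma riesz_is_linear g : linear (riesz g : H -> R^o).
Proof. by move=> a u v; rewrite /riesz ipDr ipZr. Qed.

HB.instance Definition _ g :=
  GRing.isLinear.Build R H R^o _ (riesz g) (riesz_is_linear g).

Lemma riesz_continuous g : continuous (riesz g : H -> R).
Proof.
move=> x; apply: cvg_ip; [exact: hip|exact: cvg_cst|exact: cvg_id].
Qed.

(** A quadratic error is little-o of the displacement; for the Moreau envelope
    this is the form in which differentiability is obtained. *)
Lemma is_gradient_quadratic (f : H -> R) x g K :
  (forall z, `|f z - f x - ip g (z - x)| <= K * `|z - x| ^+ 2) ->
  is_gradient ip f x g.
Proof.
move=> fq.
have fo : f \o shift x = cst (f x) + riesz g +o_ (0 : H) id.
  apply/eqaddoP => e e0; near=> h.
  have hq : `|f (h + x) - (f x + ip g h)| <= K * `|h| ^+ 2.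
    by have := fq (h + x); rewrite addrK opprD addrA.
  apply: (le_trans hq).
  rewrite (@le_trans _ _ ((`|K| + 1) * `|h| ^+ 2))//.
    by rewrite ler_wpM2r ?exprn_ge0// (le_trans (ler_norm K))// lerDl.
  rewrite expr2 mulrA ler_wpM2r// -ler_pdivlMl ?ltr_pwDr//.
  near: h; apply: nbhs0_le; rewrite mulr_gt0// invr_gt0 ltr_pwDr//.
have dE : 'd f x = riesz g :> (H -> R) by apply: diff_unique => //; exact: riesz_continuous.
split; last by move=> h; rewrite dE.
by apply/diff_locallyP; rewrite dE; split=> //; exact: riesz_continuous.
Unshelve. all: by end_near.
Qed.

Lemma gradientE (f : H -> R) x g : is_gradient ip f x g -> gradient ip f x = g.
Proof.
move=> fg; apply: xget_unique => // g' [_ fg'].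
by apply: (ip_ext hip) => h; rewrite -fg' -(fg.2 h).
Qed.

End gradient_criterion.

(** * Proximal points, the Moreau envelope and minimal norm minimizers *)

Section moreau_envelope.
Variables (R : realType) (H : completeNormedModType R) (ip : {dot H for idfun}).
Hypothesis hip : induces_norm ip.
Variable Phi : H -> \bar R.
Hypothesis Phi_convex : econvex Phi.
Hypothesis Phi_lsc : lower_semicontinuous Phi.
Variables (c0 : H) (m : R).
Hypothesis Phi_c0 : Phi c0 = m%:E.
Hypothesis Phi_ge : forall y, (m%:E <= Phi y)%E.
Implicit Types (x y z p : H) (lam mu r s : R).

Lemma Phi_fin y a : (Phi y <= a%:E)%E -> exists2 r, Phi y = r%:E & m <= r <= a.
Proof.
have := Phi_ge y; case: (Phi y) => [r| |]//.
by rewrite !lee_fin => mr ra; exists r => //; rewrite mr.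
Qed.

Lemma Phi_convex_fin y z s ry rz : 0 <= s <= 1 -> Phi y = ry%:E ->
  Phi z = rz%:E -> exists2 r, Phi (s *: y + (1 - s) *: z) = r%:E &
  r <= s * ry + (1 - s) * rz.
Proof.
move=> s01 ey ez; have := Phi_convex y z s01.
rewrite ey ez -!EFinM -EFinD => /Phi_fin[r er /andP[_ rle]].
by exists r.
Qed.

Lemma closed_sublevel (c : H -> R) r : continuous c ->
  closed [set y | (Phi y + (c y)%:E <= r%:E)%E].
Proof.
move=> cc; rewrite -openC openE => y /= /negP; rewrite -ltNge => rlt.
have [a [ra aPhi]] : exists a : R, r - c y < a /\ (a%:E < Phi y)%E.
  have := Phi_ge y; move: rlt; case: (Phi y) => [s| |]//.
    rewrite -EFinD lte_fin => h _; exists ((r - c y + s) / 2).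
    by rewrite lte_fin; split; lra.
  by move=> _ _; exists (r - c y + 1); rewrite ltry; split=> //; lra.
have [V yV aV] := Phi_lsc aPhi; rewrite /interior.
have cV : \forall z \near y, r - a < c z.
  by apply: (cvgr_gt _ (cc y)); lra.
apply: (filterS _ (filterI yV cV)) => z [/aV az /= cz]; apply/negP; rewrite -ltNge.
move: az; case: (Phi z) => [s| |]//; last by rewrite addye// !ltry.
by rewrite -EFinD !lte_fin; lra.
Qed.

(** The last argument r is the finite value of Phi at p; with it the
    minimality is an inequality between real numbers. *)
Definition is_prox lam x p r := Phi p = r%:E /\ forall y s, Phi y = s%:E ->
  r + (2 * lam)^-1 * `|x - p| ^+ 2 <= s + (2 * lam)^-1 * `|x - y| ^+ 2.

(** The approximate minimizers of the strongly convex objective form nested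
    closed sets whose diameter shrinks by the midpoint inequality. *)
Lemma prox_exists lam x : 0 < lam -> exists p r, is_prox lam x p r.
Proof.
move=> lam0; have k0 : 0 < (2 * lam)^-1 by rewrite invr_gt0 mulr_gt0.
pose K y s := s + (2 * lam)^-1 * `|x - y| ^+ 2.
pose A := [set k | exists y s, Phi y = s%:E /\ k = K y s].
have A0 : A (K c0 m) by exists c0, m.
have Alb : has_inf A.
  split; first by exists (K c0 m).
  exists m => k [y [s [ys ->]]]; have := Phi_ge y; rewrite ys lee_fin /K => ms.
  by have := mulr_ge0 (ltW k0) (exprn_ge0 2 (normr_ge0 (x - y))); lra.
have infle y s : Phi y = s%:E -> inf A <= K y s.
  by move=> ys; apply: ge_inf; [exact: Alb.2|exists y, s].
pose S d := [set y | (Phi y + ((2 * lam)^-1 * `|x - y| ^+ 2)%:E <= (inf A + d)%:E)%E].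
have SE d y : S d y -> exists2 s, Phi y = s%:E & K y s <= inf A + d.
  rewrite /S /=; have := Phi_ge y; case E : (Phi y) => [s| |]// _.
  by rewrite -EFinD lee_fin => h; exists s.
have [p Sp] : exists z, forall d, 0 < d -> S d z.
  apply: cantor_intersection.
  - move=> d e d0 de y; rewrite /S /= => /le_trans; apply.
    by rewrite lee_fin lerD2l.
  - move=> d d0; apply: closed_sublevel => y.
    apply: cvgM; first exact: cvg_cst.
    apply: (@continuous_comp _ _ _ (fun y => `|x - y|) (fun t : R => t ^+ 2)).
      by apply: cvg_norm; apply: cvgB; [exact: cvg_cst|exact: cvg_id].
    exact: exprn_continuous.
  - move=> d d0; have [|k [y [s [ys ->]]] kd] := @inf_adherent _ A d _ Alb => //.
    by exists y; rewrite /S /= ys -EFinD lee_fin ltW.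
  - move=> e e0; pose d := e ^+ 2 / (16 * lam).
    have d0 : 0 < d by rewrite divr_gt0 ?exprn_gt0 ?mulr_gt0.
    exists d => // y z /SE[sy ys Ky] /SE[sz zs Kz].
    have [|r er rle] := @Phi_convex_fin y z 2^-1 _ _ _ ys zs; first by apply/andP; split; lra.
    have := infle _ _ er; rewrite /K in Ky Kz *.
    have -> : 2^-1 *: y + (1 - 2^-1) *: z = 2^-1 *: (y + z).
      by rewrite scalerDr; congr (_ + _ *: _); lra.
    (* The quadratic term gains |y - z|^2 / 4 at the midpoint. *)
    have -> : `|x - 2^-1 *: (y + z)| ^+ 2 =
       (`|x - y| ^+ 2 + `|x - z| ^+ 2) / 2 - `|y - z| ^+ 2 / 4.
      by rewrite !hip !ipE (ipC _ y x) (ipC _ z x) (ipC _ z y); field.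
    rewrite mulrBr => h.
    have : (2 * lam)^-1 * (`|y - z| ^+ 2 / 4) <= d by lra.
    rewrite -ler_pdivlMl// /d invrK => h2.
    rewrite -(@ltr_pXn2r _ 2)// ?nnegrE//; last exact: ltW.
    have : 2 * lam * (e ^+ 2 / (16 * lam)) = e ^+ 2 / 8 by field; lra.
    have : 0 < e ^+ 2 by rewrite exprn_gt0.
    lra.
have [r pr _] := SE _ _ (Sp 1 ltr01); exists p, r; split=> // y s /infle.
apply: le_trans; apply/ler_addgt0Pr => d d0.
by have [r'] := SE _ _ (Sp d d0); rewrite pr => -[<-].
Qed.

(** First-order optimality: compare p with the point at parameter t on the
    segment from p to y and let t tend to 0. *)
Lemma prox_subgradient lam x p r : 0 < lam -> is_prox lam x p r ->
  forall y s, Phi y = s%:E -> r + ip (lam^-1 *: (x - p)) (y - p) <= s.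
Proof.
move=> lam0 [pr pmin] y s ys; rewrite ipZl.
set c := ip (x - p) (y - p).
have h t : 0 < t -> t <= 1 -> r + lam^-1 * c <= s + t * ((2 * lam)^-1 * `|y - p| ^+ 2).
  move=> t0 t1; have [|q qe qle] := @Phi_convex_fin y p t _ _ _ ys pr.
    by rewrite (ltW t0).
  have := pmin _ _ qe.
  have -> : `|x - (t *: y + (1 - t) *: p)| ^+ 2 =
      `|x - p| ^+ 2 - 2 * t * c + t ^+ 2 * `|y - p| ^+ 2.
    by rewrite /c !hip !ipE (ipC _ y x) (ipC _ p x) (ipC _ p y); ring.
  have -> : (2 * lam)^-1 = lam^-1 / 2 by rewrite invfM mulrC.
  set k := lam^-1; set n := `|y - p| ^+ 2; set n' := `|x - p| ^+ 2 => hh.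
  rewrite -(ler_pM2l t0).
  have : t * k * c - t * (t * (k / 2 * n)) <= t * s + (1 - t) * r - r by lra.
  lra.
have [|nc] := leP (r + lam^-1 * c) s => //.
set K := (2 * lam)^-1 * `|y - p| ^+ 2 in h.
have K0 : 0 <= K by rewrite mulr_ge0 ?exprn_ge0// invr_ge0 mulr_ge0// ltW.
set e := r + lam^-1 * c - s; have e0 : 0 < e by rewrite subr_gt0.
have K1 : 0 < 2 * (K + 1) by lra.
(* Small enough for the quadratic remainder t K to stay below half the gap e. *)
set t := Num.min 1 (e / (2 * (K + 1))).
have t0 : 0 < t by rewrite lt_min ltr01 divr_gt0.
have t1 : t <= 1 by rewrite ge_min lexx.
have tK : t * (2 * (K + 1)) <= e by rewrite -ler_pdivlMr// ge_min lexx orbT.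
have := h t t0 t1; rewrite /e in e0 tK *; lra.
Qed.


(** The data of the envelope at x, with gradient g and value v, in terms of the
    proximal point x - lam g. All that follows uses the envelope only through
    this predicate, which keeps the total functions [moreau] and [grad_moreau]
    out of the computations. *)
Definition is_envelope lam x g v := exists r, [/\ Phi (x - lam *: g) = r%:E,
  v = r + lam / 2 * `|g| ^+ 2 &
  forall y s, Phi y = s%:E -> r + ip g (y - (x - lam *: g)) <= s].

Lemma envelope_exists lam x : 0 < lam ->
  exists g v, is_envelope lam x g v /\ moreau Phi lam x = v%:E.
Proof.
move=> lam0; have [p [r xp]] := prox_exists x lam0.
have [pr pmin] := xp; have sub := prox_subgradient lam0 xp.
pose g := lam^-1 *: (x - p).
have gp : x - lam *: g = p by rewrite /g scalerA mulfV ?gt_eqF// scale1r subKr.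
exists g, (r + (2 * lam)^-1 * `|x - p| ^+ 2); split.
  exists r; rewrite gp; split=> //; rewrite /g normrZ exprMn ger0_norm ?invr_ge0 ?ltW//.
  by field; rewrite gt_eqF.
apply/eqP; rewrite eq_le; apply/andP; split.
  by apply: ereal_inf_lbound; exists p => //; rewrite pr.
apply: le_ereal_inf_tmp => _ [y _ <-]; have := Phi_ge y.
case E : (Phi y) => [s| |]// _; last by rewrite addye// leey.
by rewrite -EFinD lee_fin; exact: pmin.
Qed.

(** The subgradient inequality at one proximal point, evaluated at the other one.
    It lets the index lam vary together with the point; since the two points play
    symmetric roles it also gives an upper bound, and the two bounds yield the
    differentiability and the Lipschitz estimate below. *)
Lemma envelope_lower lam mu x z g h v w :
  is_envelope lam x g v -> is_envelope mu z h w ->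
  v + ip g (z - x) - (mu - lam) / 2 * `|g| ^+ 2 + mu / 2 * `|g - h| ^+ 2 <= w.
Proof.
move=> [r [pr -> sub]] [s [qs -> _]]; have := sub _ _ qs.
by rewrite !hip !ipE (ipC _ h g); lra.
Qed.

Lemma envelope_increment lam mu x z g h v w : 0 <= lam -> 0 <= mu ->
  is_envelope lam x g v -> is_envelope mu z h w ->
  0 <= w - v - (ip g (z - x) - (mu - lam) / 2 * `|g| ^+ 2) <=
    `|h - g| * `|z - x| + `|mu - lam| * `| `|h| ^+ 2 - `|g| ^+ 2 |.
Proof.
move=> lam0 mu0 gv hw; have := envelope_lower gv hw; have := envelope_lower hw gv.
have e1 : 0 <= lam / 2 * `|h - g| ^+ 2 by rewrite mulr_ge0 ?exprn_ge0 ?divr_ge0.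
have e2 : 0 <= mu / 2 * `|g - h| ^+ 2 by rewrite mulr_ge0 ?exprn_ge0 ?divr_ge0.
have -> : ip h (x - z) = - ip (h - g) (z - x) - ip g (z - x) by rewrite !ipE; ring.
have c := ip_le hip (h - g) (z - x).
have n0 : 0 <= `|mu - lam| * `| `|h| ^+ 2 - `|g| ^+ 2 | by rewrite mulr_ge0.
have := lexx (`|mu - lam| * `| `|h| ^+ 2 - `|g| ^+ 2 |).
rewrite -{1}normrM ler_norml => /andP[d _].
by move=> h1 h2; apply/andP; split; lra.
Qed.

(** Adding [envelope_lower] to its mirror image is the monotonicity of the
    subdifferential. *)
Lemma envelope_lipschitz lam mu x z g h v w : 0 < lam ->
  is_envelope lam x g v -> is_envelope mu z h w ->
  lam * `|g - h| <= `|x - z| + `|lam - mu| * `|h|.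
Proof.
move=> lam0 gv hw; have := envelope_lower gv hw; have := envelope_lower hw gv.
have [->|gh] := eqVneq g h; first by rewrite subrr normr0 mulr0 addr_ge0// mulr_ge0.
have n0 : 0 < `|g - h| by rewrite normr_gt0 subr_eq0.
move=> h1 h2; rewrite -(ler_pM2r n0).
have c1 := ip_le hip (x - z) (g - h).
have c2 := ip_le hip ((mu - lam) *: h) (g - h).
rewrite normrZ (distrC mu) in c2.
have : lam * `|g - h| ^+ 2 <= ip (x - z) (g - h) + ip ((mu - lam) *: h) (g - h).
  move: h1 h2; rewrite !hip !ipE (ipC _ h g) (ipC _ z g) (ipC _ z h).
  by rewrite (ipC _ x g) (ipC _ x h); lra.
by rewrite expr2; lra.
Qed.

Lemma grad_moreauE lam x g v : 0 < lam -> is_envelope lam x g v ->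
  grad_moreau ip Phi lam x = g.
Proof.
move=> lam0 gv; apply: (gradientE hip); apply: (is_gradient_quadratic hip (K := lam^-1)) => z.
have vE y h w : is_envelope lam y h w -> moreau Phi lam y = w%:E.
  move=> hw; have [h' [w' [hw' ->]]] := envelope_exists y lam0.
  have := envelope_lower hw hw'; have := envelope_lower hw' hw.
  have := envelope_lipschitz lam0 hw hw'; rewrite !subrr !normr0 mul0r addr0.
  rewrite pmulr_rle0// normr_le0 subr_eq0 => /eqP ->.
  rewrite !subrr !normr0 !(ip0r ip) => a b.
  by congr (_%:E); lra.
have [h [w [hw _]]] := envelope_exists z lam0.
rewrite (vE _ _ _ gv) (vE _ _ _ hw)/=.
have := envelope_lower gv hw; have := envelope_lower hw gv.
have := envelope_lipschitz lam0 gv hw; rewrite !subrr normr0 mul0r addr0.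
rewrite -ler_pdivlMl// (distrC g) (distrC x) => lip h1 h2.
have e0 : 0 <= lam / 2 * `|h - g| ^+ 2 by rewrite mulr_ge0 ?exprn_ge0 ?divr_ge0// ltW.
have c := ip_le hip (h - g) (z - x).
have c' : `|h - g| * `|z - x| <= lam^-1 * `|z - x| ^+ 2 by rewrite expr2 mulrA ler_wpM2r.
have e : ip h (x - z) = - (ip (h - g) (z - x)) - ip g (z - x) by rewrite !ipE; ring.
rewrite e in h1.
by rewrite ler_norml; apply/andP; split; lra.
Qed.

Lemma grad_moreau_envelope lam x : 0 < lam ->
  is_envelope lam x (grad_moreau ip Phi lam x) (fine (moreau Phi lam x)).
Proof.
move=> lam0; have [g [v [gv ->]]] := envelope_exists x lam0.
by rewrite (grad_moreauE lam0 gv).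
Qed.


(** Well-posedness of the selection of the minimal norm minimizer. Let r be the
    limit, as d decreases to 0, of the least norm [rho d] on the sublevel set
    [L d]. By the parallelogram identity the sets [T d] of points of [L d] with
    norm at most r + d have vanishing diameter, and their common point is z,
    with norm r. *)
Lemma minimal_norm_minimizer : exists z, [/\ Phi z = m%:E,
  forall c, Phi c = m%:E -> `|z| <= `|c| &
  forall e, 0 < e -> exists2 d, 0 < d & forall y s, Phi y = s%:E ->
    s <= m + d -> `|y| <= `|z| + d -> `|y - z| < e].
Proof.
pose L d := [set y | (Phi y <= (m + d)%:E)%E].
pose N d := [set `|y| | y in L d].
have Lmono d e : d <= e -> L d `<=` L e.
  by move=> de y; rewrite /L /= => /le_trans; apply; rewrite lee_fin lerD2l.
have minL c d : Phi c = m%:E -> 0 < d -> L d c.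
  by move=> cm d0; rewrite /L /= cm lee_fin lerDl ltW.
have Ninf d : 0 < d -> has_inf (N d).
  by move=> d0; split; [exists `|c0|, c0 => //; exact: minL|exists 0 => _ [y _ <-]].
pose rho d := inf (N d).
have rho_le d y : 0 < d -> L d y -> rho d <= `|y|.
  by move=> d0 Ly; apply: ge_inf; [exact: (Ninf d d0).2|exists y].
have rho_ge0 d : 0 < d -> 0 <= rho d.
  by move=> d0; apply: lb_le_inf; [exact: (Ninf d d0).1|move=> _ [y _ <-]].
pose P := [set rho d | d in [set d | 0 < d]].
have Psup : has_sup P.
  split; first by exists (rho 1), 1 => //=; exact: ltr01.
  by exists `|c0| => _ [d /= d0 <-]; apply: rho_le => //; exact: minL.
pose r := sup P.
have rho_r d : 0 < d -> rho d <= r.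
  by move=> d0; apply: ub_le_sup; [exact: Psup.2|exists d].
have r0 : 0 <= r by apply: le_trans (rho_r 1 ltr01); exact: rho_ge0.
have r_min c : Phi c = m%:E -> r <= `|c|.
  move=> cm; apply: ge_sup; first exact: Psup.1.
  by move=> _ [d /= d0 <-]; apply: rho_le => //; exact: minL.
pose T d := [set y | L d y /\ `|y| <= r + d].
have Tdiam e : 0 < e -> exists2 d, 0 < d & forall y z, T d y -> T d z -> `|y - z| < e.
  move=> e0.
  pose h := Num.min 1 (e ^+ 2 / (16 * (r + 1))).
  have K0 : 0 < 16 * (r + 1) by lra.
  have e20 : 0 < e ^+ 2 by rewrite exprn_gt0.
  have h0 : 0 < h by rewrite lt_min ltr01 divr_gt0.
  have h1 : h <= 1 by rewrite ge_min lexx.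
  have hK : h * (16 * (r + 1)) <= e ^+ 2 by rewrite -ler_pdivlMr// ge_min lexx orbT.
  have [_ [d1 /= d10 <-] rd1] := sup_adherent h0 Psup.
  pose d := Num.min d1 h.
  have d0 : 0 < d by rewrite lt_min d10.
  have dh : d <= h by rewrite ge_min lexx orbT.
  exists d => // y z [Ly yr] [Lz zr].
  have [sy ys /andP[_ sym]] := Phi_fin Ly; have [sz zs /andP[_ szm]] := Phi_fin Lz.
  have [|q qe qle] := @Phi_convex_fin y z 2^-1 _ _ _ ys zs.
    by apply/andP; split; lra.
  have mid : 2^-1 *: y + (1 - 2^-1) *: z = 2^-1 *: (y + z).
    by rewrite scalerDr; congr (_ + _ *: _); lra.
  have Lmid : L d1 (2^-1 *: (y + z)).
    apply: (Lmono d); first by rewrite ge_min lexx.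
    by rewrite /L /= -mid qe lee_fin; lra.
  (* The norm of the midpoint lies above r - h, those of y and z below r + h. *)
  have := rho_le _ _ d10 Lmid; have := rho_ge0 _ d10.
  have := rho_r _ d10; rewrite -/r in rd1; set n := `|2^-1 *: _|.
  set q1 := rho d1 in rd1 * => qr a0 an.
  rewrite -(@ltr_pXn2r _ 2)// ?nnegrE//; last exact: ltW.
  rewrite (parallelogram hip) -/n.
  have y2 : `|y| ^+ 2 <= (r + h) ^+ 2.
    by rewrite ler_pXn2r// ?nnegrE//; lra.
  have z2 : `|z| ^+ 2 <= (r + h) ^+ 2.
    by rewrite ler_pXn2r// ?nnegrE//; lra.
  have n2 : q1 ^+ 2 <= n ^+ 2 by rewrite ler_pXn2r// nnegrE//; lra.
  have k1 : (r + h - q1) * (r + h + q1) < (2 * h) * (r + h + q1).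
    by rewrite ltr_pM2r; lra.
  have k2 : (2 * h) * (r + h + q1) <= (2 * h) * (2 * r + 1).
    by rewrite ler_pM2l; lra.
  lra.
have [z Tz] : exists z, forall d, 0 < d -> T d z.
  apply: cantor_intersection => //.
  - move=> d e d0 de y [Ly yr]; split; first exact: Lmono Ly.
    by rewrite (le_trans yr)// lerD2l.
  - move=> d d0; rewrite /T; apply: closedI.
      rewrite (_ : L d = [set y | (Phi y + 0%:E <= (m + d)%:E)%E]).
        by apply: closed_sublevel; exact: cst_continuous.
      by apply/seteqP; split=> y; rewrite /L /= adde0.
    apply: (@closed_comp _ _ (fun y : H => `|y|) [set t | t <= r + d]).
      by move=> y _; exact: norm_continuous.
    exact: closed_le.
  - move=> d d0; have [_ [y Ly <-] yd] := inf_adherent d0 (Ninf d d0).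
    exists y; split=> //; apply: ltW; apply: (lt_le_trans yd).
    by rewrite lerD2r; exact: rho_r.
have zm : Phi z = m%:E.
  apply/eqP; rewrite eq_le Phi_ge andbT; apply/lee_addgt0Pr => d d0.
  by rewrite -EFinD; exact: (Tz d d0).1.
have zr : `|z| = r.
  apply/eqP; rewrite eq_le r_min// andbT; apply/ler_addgt0Pr => d d0.
  exact: (Tz d d0).2.
exists z; split=> //; first by move=> c cm; rewrite zr r_min.
move=> e e0; have [d d0 Td] := Tdiam e e0; exists d => // y s ys sm yz.
by apply: Td; [split; [rewrite /L /= ys lee_fin|rewrite -zr]|exact: Tz].
Qed.

End moreau_envelope.

(** * A mean value inequality off a null set *)

Section null_set_weight.
Variable R : realType.
Local Notation mu := (@lebesgue_measure R).

(** An interval function of arbitrarily small total mass which exceeds every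
    linear rate at the points of B: the sum of the Lebesgue measures of the
    traces on [[u, v[] of open sets [U n], each containing B and of measure at
    most e / 2^(n+1). A short interval around a point of B lies in as many of
    them as desired. *)
Lemma null_set_weight (B : set R) (e : R) : measurable B -> mu B = 0%E -> 0 < e ->
  exists nu : R -> R -> R, [/\ forall u v, 0 <= nu u v <= e,
    forall u m v, u <= m -> m <= v -> nu u v = nu u m + nu m v &
    forall t K, B t -> exists2 d, 0 < d &
      forall u v, u <= t -> t <= v -> v - u < d -> K * (v - u) <= nu u v].
Proof.
move=> mB B0 e0.
have cover n : exists U : set R, [/\ open U, B `<=` U & (mu U <= (e / (2 ^ n.+1)%:R)%:E)%E].
  have en : 0 < e / (2 ^ n.+1)%:R by rewrite divr_gt0// ltr0n expn_gt0.
  have muB : (mu B < +oo)%E by rewrite B0.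
  have [U [oU BU Ue]] := lebesgue_regularity_outer mB muB en.
  exists U; split=> //; apply: le_trans (ltW Ue).
  have mU : measurable U by exact: open_measurable.
  by rewrite (measureDI mu mU mB) (setIidr BU) [X in (_ + X)%E]B0 adde0.
have [U Uprop] := choice cover.
have oU n : open (U n) by have [] := Uprop n.
have BU n : B `<=` U n by have [] := Uprop n.
have muU n : (mu (U n) <= (e / (2 ^ n.+1)%:R)%:E)%E by have [] := Uprop n.
have mU n : measurable (U n) by exact: open_measurable.
have mI u v n : measurable (U n `&` [set` `[u, v[]).
  by apply: measurableI; [exact: mU|exact: measurable_itv].
pose W u v n := mu (U n `&` [set` `[u, v[]).
have W0 u v n : (0 <= W u v n)%E by exact: measure_ge0.
pose S u v := (\sum_(0 <= n <oo) W u v n)%E.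
have Se u v : (S u v <= e%:E)%E.
  apply: (@le_trans _ _ (\sum_(0 <= n <oo) (e / (2 ^ n.+1)%:R)%:E)%E).
    apply: lee_nneseries => // n _; apply: le_trans (muU n).
    by apply: le_measure; rewrite ?inE; [exact: mI|exact: mU|exact: subIsetl].
  exact/epsilon_trick0/ltW.
have S0 u v : (0 <= S u v)%E by exact: nneseries_ge0.
have Sfin u v : S u v \is a fin_num.
  by rewrite ge0_fin_numE// (le_lt_trans (Se _ _))// ltry.
exists (fun u v => fine (S u v)); split.
- by move=> u v; rewrite fine_ge0//= -lee_fin fineK.
- move=> u m v um mv; rewrite -fineD//; congr fine.
  rewrite /S -nneseriesD//; apply: eq_eseriesr => n _.
  rewrite /W -measureU; [|exact: mI|exact: mI|]; last first.
    rewrite -setIIr; apply/seteqP; split=> // y [_ []] /=.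
    by rewrite !in_itv/= => /andP[_ ym] /andP[my _]; move: (lt_le_trans ym my); rewrite ltxx.
  congr (lebesgue_measure _); rewrite -setIUr; congr (_ `&` _).
  apply/seteqP; split=> y /=; rewrite !in_itv/=.
    move=> /andP[uy yv]; have [ym|my] := ltP y m; [left|right]; by rewrite ?uy ?yv ?ym ?my.
  by move=> [/andP[-> ym]|/andP[my ->]]; rewrite ?andbT ?(lt_le_trans ym)// (le_trans um).
- move=> t K Bt; pose k := Num.truncn `|K|.
  have Kk : K <= k.+1%:R by rewrite (le_trans (ler_norm _))// ltW// truncnS_gt.
  have : \forall y \near t, forall i : 'I_k.+1, U i y.
    apply: (@filter_forall _ _ (fun (i : 'I_k.+1) y => U i y) _ (nbhs_filter t)) => i.
    by apply: open_nbhs_nbhs; split; [exact: oU|exact: BU].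
  move=> /nbhs_ballP[d /= d0 dU]; exists d => // u v ut tv vud.
  have [uv|vu] := ltP u v; last first.
    have -> : v - u = 0 by apply/eqP; rewrite subr_eq0 eq_le vu (le_trans ut).
    by rewrite mulr0 fine_ge0.
  rewrite -lee_fin fineK//.
  apply: (@le_trans _ _ (\sum_(0 <= n < k.+1) W u v n)%E); last exact: nneseries_lim_ge.
  rewrite big_mkord (eq_bigr (fun=> (v - u)%:E)); last first.
    move=> i _; rewrite /W setIidr.
      by rewrite lebesgue_measure_itv/= lte_fin uv.
    move=> y /=; rewrite in_itv/= => /andP[uy yv]; apply: dU.
    by rewrite /ball/= ltr_norml; apply/andP; split; lra.
  rewrite sumEFin lee_fin sumr_const card_ord -mulr_natl.
  by rewrite ler_wpM2r// subr_ge0 ltW.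
Qed.

End null_set_weight.

Section mean_value_off_null_set.
Variable R : realType.
Local Notation mu := (@lebesgue_measure R).

(** Cousin's lemma in the form of an induction principle: an additive property of
    intervals that holds for all short intervals around each point holds
    globally. The supremum of the right ends reached from a is b. *)
Lemma interval_additive_induction (a b : R) (P : R -> R -> Prop) : a <= b ->
  (forall u m v, a <= u -> u <= m -> m <= v -> v <= b -> P u m -> P m v -> P u v) ->
  (forall t, a <= t -> t <= b -> exists2 d, 0 < d & forall u v, a <= u ->
     u <= t -> t <= v -> v <= b -> v - u < d -> P u v) ->
  P a b.
Proof.
move=> ab Padd Ploc.
pose S := [set s | a <= s <= b /\ P a s].
have Sa : S a.
  split; first by rewrite lexx.
  by have [d d0 Pd] := Ploc a (lexx a) ab; apply: Pd; rewrite ?subrr.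
have Ssup : has_sup S by split; [exists a|exists b => s [/andP[]]].
pose c := sup S.
have ac : a <= c by apply: ub_le_sup => //; exact: Ssup.2.
have cb : c <= b by apply: ge_sup; [exact: Ssup.1|move=> s [/andP[]]].
have [d d0 Pd] := Ploc c ac cb.
have d20 : 0 < d / 2 by rewrite divr_gt0.
have [s [/andP[as_ sb] Ps] cs] := sup_adherent d20 Ssup.
have sc : s <= c by apply: ub_le_sup => //; [exact: Ssup.2|split => //; rewrite as_].
pose v := Num.min b (c + d / 3).
have vb : v <= b by rewrite ge_min lexx.
have cv : c <= v by rewrite le_min cb lerDl divr_ge0// ltW.
have vc : v <= c + d / 3 by rewrite ge_min lexx orbT.
have Pv : P a v.
  apply: (Padd a s v) => //; first exact: le_trans cv.
  by apply: Pd => //; rewrite -/c in cs; lra.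
have : v <= c.
  by apply: ub_le_sup; [exact: Ssup.2|split => //; rewrite vb (le_trans ac)].
rewrite ge_min => /orP[bc|]; last lra.
suff -> : b = v by [].
by apply/eqP; rewrite eq_le vb andbT (le_trans bc).
Qed.

Variable V : normedModType R.

Let total_length (s : seq (R * R)) := \sum_(p <- s) (p.2 - p.1).

Let total_increment (y : R -> V) (s : seq (R * R)) := \sum_(p <- s) `|y p.2 - y p.1|.

Let nonoverlapping a b (s : seq (R * R)) :=
  all (fun p => [&& a <= p.1, p.1 <= p.2 & p.2 <= b]) s
  && pairwise (fun p q => p.2 <= q.1) s.

(** Finite families of intervals as sequences, which can be concatenated. *)
Lemma abs_continuous_seq (a b : R) (y : R -> V) (e : R) :
  abs_continuous a b y -> 0 < e -> exists2 d, 0 < d & forall s,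
    nonoverlapping a b s -> total_length s < d -> total_increment y s < e.
Proof.
move=> yac e0; have [d d0 yd] := yac e e0; exists d => // s /andP[/allP sab sp].
pose u (i : 'I_(size s)) := (nth (0, 0) s i).1.
pose v (i : 'I_(size s)) := (nth (0, 0) s i).2.
rewrite /total_length /total_increment !(big_nth (0, 0)) !big_mkord => sd.
apply: (yd _ u v) => //.
  by move=> i; have /sab/and3P[] := mem_nth (0, 0) (ltn_ord i).
have lt_disj (i j : 'I_(size s)) z : (i < j)%N -> `]u i, v i[%classic z ->
    `]u j, v j[%classic z -> False.
  move=> ij /=; rewrite !in_itv/= => /andP[_ zi] /andP[jz _].
  have := (pairwiseP (0, 0) sp) i j (ltn_ord i) (ltn_ord j) ij.
  by move=> /(lt_le_trans zi) /lt_trans /(_ jz); rewrite ltxx.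
apply/trivIsetP => i j _ _ ij; apply/seteqP; split=> // z [zi zj].
have [lt_ij|lt_ji|/val_inj eq_ij] := ltngtP (i : nat) j.
- exact: lt_disj zi zj.
- exact: lt_disj zj zi.
- by rewrite eq_ij eqxx in ij.
Qed.

(** If u has speed at most om outside a null set, then om bounds its mean speed,
    provided that u has small variation on the null set. The latter holds when,
    near each point t, the increment of u from t is at most K_t |s - t| plus a
    fixed multiple of the increment of an absolutely continuous y: the first
    part is paid by [null_set_weight] whatever the rates K_t are, the second by
    the absolute continuity of y. *)
Lemma mean_value_off_null_set (a b om : R) (u y : R -> V) : a <= b -> 0 <= om ->
  abs_continuous a b y ->
  {ae mu, forall t, a <= t <= b -> forall e, 0 < e -> exists2 d, 0 < d &
     forall s, a <= s <= b -> `|s - t| < d -> `|u s - u t| <= (om + e) * `|s - t|} ->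
  (exists2 C, 0 <= C & forall t, a <= t <= b -> exists K, exists2 d, 0 < d &
     forall s, a <= s <= b -> `|s - t| < d ->
       `|u s - u t| <= K * `|s - t| + C * `|y s - y t|) ->
  `|u b - u a| <= om * (b - a).
Proof.
move=> ab om0 yac [B [mB B0 nB]] [C C0 uC].
have {}nB t : ~ B t -> a <= t <= b -> forall e, 0 < e -> exists2 d, 0 < d &
     forall s, a <= s <= b -> `|s - t| < d -> `|u s - u t| <= (om + e) * `|s - t|.
  move=> Bt; apply: contrapT => h; exact/Bt/nB.
apply/ler_addgt0Pr => e e0.
pose e1 := e / (3 * (C + 1)).
pose e2 := e / (3 * (b - a + 1)).
have e10 : 0 < e1 by rewrite divr_gt0// mulr_gt0//; lra.
have e20 : 0 < e2 by rewrite divr_gt0// mulr_gt0//; lra.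
have [d d0 yd] := abs_continuous_seq yac e10.
have h0 : 0 < Num.min (e / 3) (d / 2) by rewrite lt_min !divr_gt0.
have [nu [nu_bd nuD nuB]] := null_set_weight mB B0 h0.
(* The list s collects the intervals around exceptional points. Their total
   length is controlled by nu, hence their y-increment by absolute continuity. *)
pose P p q := exists s, [/\ nonoverlapping p q s, total_length s <= nu p q &
  `|u q - u p| <= (om + e2) * (q - p) + C * total_increment y s + nu p q].
suff [s [sab sl us]] : P a b.
  have := nu_bd a b; rewrite le_min => /and3P[_ nu1 nu2].
  have /(yd _ sab) sy : total_length s < d by apply: (le_lt_trans (le_trans sl nu2)); lra.
  apply: (le_trans us).
  have : C * total_increment y s <= C * e1 by rewrite ler_wpM2l// ltW.
  have : C * e1 <= e / 3.
    rewrite /e1 mulrA ler_pdivrMr; last lra.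
    by rewrite mulrC -mulrA ler_pM2l// ; lra.
  have : e2 * (b - a) <= e / 3.
    rewrite /e2 mulrAC ler_pdivrMr; last lra.
    by rewrite -mulrA ler_pM2l//; lra.
  lra.
apply: interval_additive_induction => //.
  move=> p m q ap pm mq qb [s1 [/andP[s1a s1p] l1 u1]] [s2 [/andP[s2a s2p] l2 u2]].
  exists (s1 ++ s2); rewrite /total_length /total_increment !big_cat/= (nuD p m q)//.
  split.
  - rewrite /nonoverlapping all_cat pairwise_cat s1p s2p !andbT.
    apply/andP; split.
      apply/andP; split; apply/allP => z.
        move=> /(allP s1a)/and3P[z1 -> z2]; rewrite z1/=; exact: le_trans mq.
      by move=> /(allP s2a)/and3P[z1 -> ->]; rewrite (le_trans pm).
    apply/allrelP => z w /(allP s1a)/and3P[_ _ zm] /(allP s2a)/and3P[mw _ _].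
    exact: le_trans mw.
  - exact: lerD.
  - have -> : u q - u p = (u m - u p) + (u q - u m) by rewrite [RHS]addrC addrA subrK.
    rewrite (le_trans (ler_normD _ _))//; rewrite /total_increment in u1 u2; lra.
move=> t at_ tb; have tab : a <= t <= b by rewrite at_.
have split_at p q : u q - u p = (u q - u t) - (u p - u t) by rewrite opprB addrA subrK.
have [Bt|Bt] := pselect (B t).
  have [K [d1 d10 ut]] := uC t tab.
  have [d2 d20 nut] := nuB t (Num.max K 1) Bt.
  exists (Num.min d1 d2); rewrite ?lt_min ?d10// => p q ap pt tq qb.
  rewrite lt_min => /andP[qp1 qp2].
  have := nut _ _ pt tq qp2.
  have pq0 : 0 <= q - p by rewrite subr_ge0 (le_trans pt).
  have KM : K * (q - p) <= Num.max K 1 * (q - p) by rewrite ler_wpM2r// le_max lexx.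
  have M1 : 1 * (q - p) <= Num.max K 1 * (q - p) by rewrite ler_wpM2r// le_max lexx orbT.
  move=> nupq.
  exists [:: (p, t); (t, q)]; rewrite /total_length /total_increment !big_cons !big_nil/=.
  split.
  - by rewrite /nonoverlapping /= lexx pt tq !lexx.
  - lra.
  - have := ut q; have := ut p.
    have -> : `|q - t| = q - t by rewrite ger0_norm// subr_ge0.
    have -> : `|p - t| = t - p by rewrite distrC ger0_norm// subr_ge0.
    rewrite ap (le_trans pt)// qb (le_trans at_)//.
    move=> /(_ isT) h1 /(_ isT) h2.
    have {}h1 := h1 ltac:(lra); have {}h2 := h2 ltac:(lra).
    rewrite (split_at p q) (le_trans (ler_normB _ _))//.
    rewrite (distrC (y p)) in h1.
    have : 0 <= (om + e2) * (q - p) by rewrite mulr_ge0// addr_ge0// ltW.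
    lra.
have [d1 d10 ut] := nB t Bt tab e2 e20.
exists d1 => // p q ap pt tq qb qpd.
exists [::]; rewrite /total_length /total_increment !big_nil; split => //.
  by have /andP[] := nu_bd p q.
have := ut q; have := ut p.
have -> : `|q - t| = q - t by rewrite ger0_norm// subr_ge0.
have -> : `|p - t| = t - p by rewrite distrC ger0_norm// subr_ge0.
rewrite ap (le_trans pt)// qb (le_trans at_)//.
move=> /(_ isT) h1 /(_ isT) h2.
have {}h1 := h1 ltac:(lra); have {}h2 := h2 ltac:(lra).
rewrite (split_at p q) (le_trans (ler_normB _ _))//.
have /andP[n0 _] := nu_bd p q.
lra.
Qed.

End mean_value_off_null_set.

(** * Derivatives on a half-line *)

Section half_line_derivative.
Variables (R : realType) (V : normedModType R) (t0 : R).
Implicit Types (f g : R -> V) (t : R).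

Lemma near_dist t r : 0 < r -> \forall s \near t, `|s - t| < r.
Proof. by move=> r0; exists r => //= s; rewrite /ball/= distrC. Qed.

Lemma hl_derivable_linear_approx f t e : hl_derivable t0 f t -> 0 < e ->
  exists2 d, 0 < d & forall s, t0 <= s -> `|s - t| < d ->
    `|f s - f t - (s - t) *: hl_derive t0 f t| <= e * `|s - t|.
Proof.
move=> ft e0; have /cvgrPdist_le /(_ e e0) := ft.
rewrite -/(hl_derive t0 f t) => /nbhs_ballP[d /= d0 fd]; exists d => // s s0 sd.
have [->|st] := eqVneq s t; first by rewrite !subrr scale0r subrr !normr0 mulr0.
have := fd s; rewrite /ball/= distrC => /(_ sd st).
rewrite /= in_itv/= andbT => /(_ s0); rewrite distrC /half_line_slope => h.
have st0 : s - t != 0 by rewrite subr_eq0.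
have -> : f s - f t - (s - t) *: hl_derive t0 f t =
    (s - t) *: ((s - t)^-1 *: (f s - f t) - hl_derive t0 f t).
  by rewrite scalerBr scalerA mulfV// scale1r.
by rewrite normrZ mulrC ler_wpM2r.
Qed.

(** Only increments from t itself are compared, and K may depend on t without any
    bound. This is all that differentiability at each point provides. *)
Definition pointwise_lipschitz f t := exists2 K, 0 <= K & exists2 d, 0 < d &
  forall s, t0 <= s -> `|s - t| < d -> `|f s - f t| <= K * `|s - t|.

Lemma hl_derivable_lipschitz f t : hl_derivable t0 f t -> pointwise_lipschitz f t.
Proof.
move=> ft; have [d d0 fd] := hl_derivable_linear_approx ft ltr01.
exists (1 + `|hl_derive t0 f t|); first by rewrite addr_ge0.
exists d => // s s0 sd; have := fd s s0 sd => h.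
rewrite -(subrK ((s - t) *: hl_derive t0 f t) (f s - f t)).
by rewrite (le_trans (ler_normD _ _))// normrZ mulrDl lerD// mulrC.
Qed.

Lemma lipschitz_continuous_at f t : t0 < t -> pointwise_lipschitz f t ->
  {for t, continuous f}.
Proof.
move=> t0t [K K0 [d d0 fK]]; apply/cvgrPdist_le => e e0.
have K1 : 0 < K + 1 by rewrite ltr_wpDl.
near=> s.
have s0 : t0 <= s by apply: ltW; near: s; exact: lt_nbhsr.
have sd : `|s - t| < Num.min d (e / (K + 1)).
  by near: s; apply: near_dist; rewrite lt_min d0 divr_gt0.
move: sd; rewrite lt_min => /andP[sd se].
rewrite distrC (le_trans (fK s s0 sd))//.
rewrite ltr_pdivlMr// in se; have := normr_ge0 (s - t); lra.
Unshelve. all: by end_near. Qed.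

Lemma is_derive_linear_approx f t l :
  (forall e, 0 < e -> \forall s \near t, `|f s - f t - (s - t) *: l| <= e * `|s - t|) ->
  is_derive t 1 f l.
Proof.
move=> h.
have fl : (fun h => h^-1 *: ((f \o shift t) (h *: 1) - f t)) @ 0^' --> l.
  apply/cvgrPdist_le => e e0; near=> u.
  have u0 : u != 0 by near: u; exact: nbhs_dnbhs_neq.
  have : `|f (u + t) - f t - (u + t - t) *: l| <= e * `|u + t - t|.
    near: u; apply: (@cvg_within _ (nbhs 0)).
    have := h e e0; rewrite (near_shift 0 t)/=; apply: filterS => u.
    by rewrite /shift/= subr0.
  rewrite addrK /= [u *: 1]mulr1 => hu.
  have -> : l - u^-1 *: (f (u + t) - f t) = - (u^-1 *: (f (u + t) - f t - u *: l)).
    by rewrite [X in _ = - X]scalerBr scalerA mulVf// scale1r opprB.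
  rewrite normrN normrZ normfV ler_pdivrMl ?normr_gt0//.
  by rewrite mulrC.
apply: DeriveDef; first by apply/cvg_ex; exists l.
exact: cvg_lim.
Unshelve. all: by end_near. Qed.

Lemma hl_derivable_is_derive f t : t0 < t -> hl_derivable t0 f t ->
  is_derive t 1 f (hl_derive t0 f t).
Proof.
move=> t0t ft; apply: is_derive_linear_approx => e e0.
have [d d0 fd] := hl_derivable_linear_approx ft e0; near=> s; apply: fd.
  by apply: ltW; near: s; exact: lt_nbhsr.
by near: s; exact: near_dist.
Unshelve. all: by end_near. Qed.

Lemma is_derive_continuous_at f t l : is_derive t 1 f l -> {for t, continuous f}.
Proof. by move=> [ft _]; apply/differentiable_continuous/derivable1_diffP. Qed.

(** With the slopes taken at a moving point s rather than at increments, the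
    product rules for [ip] and for scaling reduce to algebra of limits. *)
Lemma is_derive_slopeP f t l : is_derive t 1 f l <->
  (s - t)^-1 *: (f s - f t) @[s --> t^'] --> l.
Proof.
split=> [[ft fl]|fl].
  apply/cvgrPdist_le => e e0.
  have : \forall u \near 0^', `|l - u^-1 *: (f (u *: 1 + t) - f t)| <= e.
    by move: ft; rewrite /derivable -/(derive f t 1) fl => /cvgrPdist_le; apply.
  move=> /nbhs_ballP[d /= d0 fd]; apply/nbhs_ballP; exists d => // s /= sd st.
  have := fd (s - t); rewrite /ball/= sub0r normrN distrC subr_eq0.
  by move=> /(_ sd st); rewrite [_ *: 1]mulr1 subrK.
apply: is_derive_linear_approx => e e0.
have /cvgrPdist_le/(_ e e0)/nbhs_ballP[d /= d0 fd] := fl.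
apply/nbhs_ballP; exists d => // s /= sd.
have [->|st] := eqVneq s t; first by rewrite !subrr scale0r subrr !normr0 mulr0.
have st0 : s - t != 0 by rewrite subr_eq0.
have -> : f s - f t - (s - t) *: l = - ((s - t) *: (l - (s - t)^-1 *: (f s - f t))).
  by rewrite [X in _ = - X]scalerBr scalerA mulfV// scale1r opprB.
by rewrite normrN normrZ mulrC ler_wpM2r//; exact: fd.
Qed.

Lemma continuous_within_half_line f t : t0 < t ->
  {within [set` `[t0, +oo[], continuous f} -> {for t, continuous f}.
Proof.
move=> t0t /continuous_within_itvcyP[+ _] => /(_ t); apply.
by rewrite in_itv/= t0t.
Qed.

Lemma abs_continuousW (a b c d : R) f : a <= c -> d <= b ->
  abs_continuous a b f -> abs_continuous c d f.
Proof.
move=> ac db fab e e0; have [r r0 fr] := fab e e0; exists r => // n u v uv.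
apply: fr => i; have [cu [-> vd]] := uv i.
by split; [exact: le_trans cu|split => //; exact: le_trans db].
Qed.

End half_line_derivative.

Lemma scale_mul (R : realType) (a b : R) : a *: b = a * b.
Proof. by []. Qed.

Section derivative_inner_product.
Variables (R : realType) (H : normedModType R) (ip : {dot H for idfun}).
Hypothesis hip : induces_norm ip.

Lemma is_derive_ip (u v : R -> H) (t : R) (du dv : H) :
  is_derive t 1 u du -> is_derive t 1 v dv ->
  is_derive t 1 (fun s => ip (u s) (v s)) (ip du (v t) + ip (u t) dv).
Proof.
move=> hu hv; apply/is_derive_slopeP.
have /is_derive_slopeP su := hu; have /is_derive_slopeP sv := hv.
have cv : v s @[s --> t^'] --> v t.
  by apply: cvg_within_filter; exact: is_derive_continuous_at hv.
rewrite (_ : (fun s => _) = fun s =>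
    ip ((s - t)^-1 *: (u s - u t)) (v s) + ip (u t) ((s - t)^-1 *: (v s - v t))).
  by apply: cvgD; apply: (cvg_ip hip) => //; exact: cvg_cst.
by apply/funext => s; rewrite !ipE /GRing.scale/=; ring.
Qed.

Lemma is_derive_scale (V : normedModType R) (c : R -> R) (u : R -> V) (t dc : R) (du : V) :
  is_derive t 1 c dc -> is_derive t 1 u du ->
  is_derive t 1 (fun s => c s *: u s) (dc *: u t + c t *: du).
Proof.
move=> hc hu; apply/is_derive_slopeP.
have /is_derive_slopeP sc := hc; have /is_derive_slopeP su := hu.
have cu : u s @[s --> t^'] --> u t.
  by apply: cvg_within_filter; exact: is_derive_continuous_at hu.
rewrite (_ : (fun s => _) = fun s =>
    ((s - t)^-1 *: (c s - c t)) *: u s + c t *: ((s - t)^-1 *: (u s - u t))).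
  by apply: cvgD; apply: cvgZ => //; exact: cvg_cst.
apply/funext => s.
rewrite /= -[(s - t)^-1 *: (c s - c t)]/((s - t)^-1 * (c s - c t)).
rewrite (scalerA (c t)) (mulrC (c t)) -!scalerA -scalerDr.
by congr (_ *: _); rewrite scalerBl scalerBr addrA subrK.
Qed.

End derivative_inner_product.

(** * Regularity of the trajectory *)

Section trajectory_regularity.
Variables (R : realType) (H : completeNormedModType R) (ip : {dot H for idfun}).
Hypothesis hip : induces_norm ip.
Variable Phi : H -> \bar R.
Variables (t0 : R) (lam : R -> R) (x : R -> H).
Hypothesis lam_gt0 : forall t, t0 <= t -> 0 < lam t.
Hypothesis lam_ndecr : forall s t, t0 <= s -> s <= t -> lam s <= lam t.
Hypothesis lam_diff : hl_differentiable t0 lam.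
Hypothesis x_diff : hl_differentiable t0 x.

Local Notation v := (hl_derive t0 x).

Variables (g : R -> H) (env : R -> R).
Hypothesis envelope_along : forall t, t0 <= t ->
  is_envelope ip Phi (lam t) (x t) (g t) (env t).

(** The monotone lam stays above lam t0 > 0, which keeps the Lipschitz constant
    of the gradient of the envelope under control. *)
Lemma grad_along_lipschitz t : t0 <= t -> pointwise_lipschitz t0 g t.
Proof.
move=> t0t; have l0 := lam_gt0 (lexx t0).
have [Kx Kx0 [dx dx0 xK]] := hl_derivable_lipschitz (x_diff t0t).
have [Kl Kl0 [dl dl0 lK]] := hl_derivable_lipschitz (lam_diff t0t).
exists ((Kx + Kl * `|g t|) / lam t0); first by rewrite divr_ge0 ?addr_ge0 ?mulr_ge0// ltW.
exists (Num.min dx dl); first by rewrite lt_min dx0.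
move=> s t0s; rewrite lt_min => /andP[sx sl].
have := envelope_lipschitz hip (lam_gt0 t0s) (envelope_along t0s) (envelope_along t0t).
have := xK s t0s sx; have := lK s t0s sl; set D := `|s - t|.
move=> h1 h2 h3; rewrite mulrAC ler_pdivlMr// mulrC.
have h4 : lam t0 * `|g s - g t| <= lam s * `|g s - g t|.
  by rewrite ler_wpM2r// lam_ndecr.
have h5 : `|lam s - lam t| * `|g t| <= Kl * D * `|g t| by rewrite ler_wpM2r.
lra.
Qed.

Lemma grad_along_continuous t : t0 < t -> {for t, continuous g}.
Proof.
by move=> t0t; apply: (lipschitz_continuous_at t0t); exact/grad_along_lipschitz/ltW.
Qed.

(** Up to the error in [envelope_increment], the envelope moves like the function
    L below, in which the gradient is frozen at time t. The error is a product of
    two small increments, hence negligible with respect to s - t. *)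
Lemma is_derive_envelope_along t : t0 < t ->
  is_derive t 1 env (ip (g t) (v t) - hl_derive t0 lam t / 2 * `|g t| ^+ 2).
Proof.
move=> t0t; have t0t' := ltW t0t.
pose L s := ip (g t) (x s) - lam s / 2 * `|g t| ^+ 2.
have dx := hl_derivable_is_derive t0t (x_diff t0t').
have dl := hl_derivable_is_derive t0t (lam_diff t0t').
have dL : is_derive t 1 L (ip (g t) (v t) - hl_derive t0 lam t / 2 * `|g t| ^+ 2).
  have := is_derive_ip hip (is_derive_cst (g t) t 1) dx; rewrite (ip0l ip) add0r => d1.
  have := is_deriveB d1 (is_deriveZ (`|g t| ^+ 2 / 2) dl).
  have -> : (fun s => ip (cst (g t) s) (x s)) - (`|g t| ^+ 2 / 2) \*: lam = L.
    by apply/funext => s; rewrite /L !fctE /cst /= !scale_mul; ring.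
  by move/is_derive_eq; apply; rewrite /cst/= !scale_mul; ring.
have dD : is_derive t 1 (env - L) 0.
  apply: is_derive_linear_approx => e e0.
  have [Kx Kx0 [rx rx0 xK]] := hl_derivable_lipschitz (x_diff t0t').
  have [Kl Kl0 [rl rl0 lK]] := hl_derivable_lipschitz (lam_diff t0t').
  have gc := grad_along_continuous t0t.
  have gc2 : `|g s| ^+ 2 @[s --> t] --> `|g t| ^+ 2.
    have gn : `|g s| @[s --> t] --> `|g t| by exact: cvg_norm.
    by under eq_fun do rewrite expr2; rewrite expr2; exact: cvgM.
  pose e1 := e / (Kx + Kl + 1).
  have K0 : 0 < Kx + Kl + 1 by lra.
  have e10 : 0 < e1 by rewrite divr_gt0.
  near=> s.
  have t0s : t0 <= s by apply: ltW; near: s; exact: lt_nbhsr.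
  have := xK s t0s; have := lK s t0s.
  move=> /(_ ltac:(near: s; exact: near_dist)) hl /(_ ltac:(near: s; exact: near_dist)) hx.
  have g1 : `|g s - g t| <= e1.
    by rewrite distrC; near: s; exact: cvgr_dist_le gc _ e10.
  have g2 : `| `|g s| ^+ 2 - `|g t| ^+ 2 | <= e1.
    by rewrite distrC; near: s; exact: cvgr_dist_le gc2 _ e10.
  have := envelope_increment hip (ltW (lam_gt0 t0t')) (ltW (lam_gt0 t0s))
    (envelope_along t0t') (envelope_along t0s).
  have -> : (env - L) s - (env - L) t - (s - t) *: 0 =
      env s - env t -
      (ip (g t) (x s - x t) - (lam s - lam t) / 2 * `|g t| ^+ 2).
    by rewrite scaler0 subr0 !fctE /L ipDr ipNr; ring.
  move=> /andP[D0 D1]; rewrite ger0_norm//; apply: (le_trans D1).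
  have c1 : `|g s - g t| * `|x s - x t| <= e1 * (Kx * `|s - t|) by apply: ler_pM.
  have c2 : `|lam s - lam t| * `| `|g s| ^+ 2 - `|g t| ^+ 2 | <= Kl * `|s - t| * e1.
    by apply: ler_pM.
  apply: (le_trans (lerD c1 c2)).
  have -> : e = e1 * (Kx + Kl + 1) by rewrite /e1 divfK// gt_eqF.
  have c7 : 0 <= e1 * `|s - t| by rewrite mulr_ge0// ltW.
  lra.
have := is_deriveD dD dL; rewrite add0r.
by rewrite (_ : env - L + L = env)// subrK.
Unshelve. all: by end_near. Qed.

Section velocity.
Variables (alpha beta : R) (b eps : R -> R).
Hypothesis beta_gt0 : 0 < beta.
Hypothesis t0_gt0 : 0 < t0.
Hypothesis b_diff : hl_differentiable t0 b.
Hypothesis eps_diff : hl_differentiable t0 eps.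
Hypothesis v_cont : {within [set` `[t0, +oo[], continuous v}.
Hypothesis v_ac : loc_abs_continuous t0 v.
Hypothesis ode : {ae @lebesgue_measure R, forall t, t0 <= t ->
  [/\ hl_derivable t0 v t, hl_derivable t0 g t &
      hl_derive t0 v t + (alpha / t) *: v t + beta *: hl_derive t0 g t
      + b t *: g t + eps t *: x t = 0]}.

(** The value that the equation assigns to the derivative of v + beta g. *)
Definition inertial_force t := - ((alpha / t) *: v t + b t *: g t + eps t *: x t).

Lemma inertial_force_continuous t : t0 < t -> {for t, continuous inertial_force}.
Proof.
move=> t0t; have t0t' := ltW t0t.
have bc := lipschitz_continuous_at t0t (hl_derivable_lipschitz (b_diff t0t')).
have ec := lipschitz_continuous_at t0t (hl_derivable_lipschitz (eps_diff t0t')).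
have xc := lipschitz_continuous_at t0t (hl_derivable_lipschitz (x_diff t0t')).
have vc := continuous_within_half_line t0t v_cont.
have gc := grad_along_continuous t0t.
apply: cvgN; apply: cvgD; first apply: cvgD.
- apply: cvgZ => //; apply: cvgM; first exact: cvg_cst.
  by apply: cvgV; [rewrite gt_eqF// (lt_trans t0_gt0)|exact: cvg_id].
- exact: cvgZ.
- exact: cvgZ.
Qed.

Let increment_split (z r : R) (vz vr gz gr dv dg F : H) :
  vz + beta *: gz - z *: F - (vr + beta *: gr - r *: F) =
  (vz - vr - (z - r) *: dv) + beta *: (gz - gr - (z - r) *: dg) +
  (z - r) *: (dv + beta *: dg - F).
Proof. by apply: (ip_ext hip) => h; rewrite !ipE; ring. Qed.

Let increment_split0 (z r : R) (vz vr gz gr F : H) :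
  vz + beta *: gz - z *: F - (vr + beta *: gr - r *: F) =
  (vz - vr) + (beta *: (gz - gr) - (z - r) *: F).
Proof. by apply: (ip_ext hip) => h; rewrite !ipE; ring. Qed.

Let increment_split1 (z r : R) (vz vr gz gr F : H) :
  vz + beta *: gz - (vr + beta *: gr) - (z - r) *: F =
  vz + beta *: gz - z *: F - (vr + beta *: gr - r *: F).
Proof. by apply: (ip_ext hip) => h; rewrite !ipE; ring. Qed.

(** Subtract from v + beta g its tangent at t. Near t the difference u has speed
    at most e almost everywhere, as the force is continuous, and
    [mean_value_off_null_set] with y := v turns this into a bound on its
    increments. *)
Lemma is_derive_velocity t : t0 < t ->
  is_derive t 1 (fun s => v s + beta *: g s) (inertial_force t).
Proof.
move=> t0t; apply: is_derive_linear_approx => e e0.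
have : \forall s \near t, t0 < s /\ `|inertial_force s - inertial_force t| <= e.
  near=> s; split; first by near: s; exact: lt_nbhsr.
  rewrite distrC; near: s.
  exact: cvgr_dist_le (inertial_force_continuous t0t) _ e0.
move=> /nbhs_ballP[d /= d0 near_t]; apply/nbhs_ballP; exists d => // s sd.
pose w s := v s + beta *: g s.
pose u r := w r - r *: inertial_force t.
have mv p q : p <= q -> (forall r, p <= r <= q -> ball t d r) -> `|u q - u p| <= e * (q - p).
  move=> pq inball.
  have t0p : t0 <= p by apply/ltW; apply: (near_t p _).1; apply: inball; rewrite lexx.
  apply: (@mean_value_off_null_set R H p q e u v) => //; first exact: ltW.
  - by apply: abs_continuousW (v_ac (le_trans t0p pq)).
  - apply: (@filterS _ _ (ae_filter_ringOfSetsType (@lebesgue_measure R)) _ _ _ ode).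
    move=> r ode_r rpq e' e'0.
    have t0r : t0 <= r by case/andP: rpq => pr _; exact: le_trans pr.
    have [dv dg ode_eq] := ode_r t0r.
    pose e1 := e' / (1 + beta).
    have b1 : 0 < 1 + beta by rewrite addr_gt0.
    have e10 : 0 < e1 by rewrite divr_gt0.
    have [d1 d10 h1] := hl_derivable_linear_approx dv e10.
    have [d2 d20 h2] := hl_derivable_linear_approx dg e10.
    exists (Num.min d1 d2); first by rewrite lt_min d10.
    move=> z /andP[pz zq]; rewrite lt_min => /andP[z1 z2].
    have t0z : t0 <= z by exact: le_trans pz.
    have {}h1 := h1 z t0z z1; have {}h2 := h2 z t0z z2.
    have fr : `|inertial_force r - inertial_force t| <= e.
      exact: (near_t r (inball _ rpq)).2.
    have forceE : inertial_force r = hl_derive t0 v r + beta *: hl_derive t0 g r.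
      apply: (ip_ext hip) => h; have := congr1 (ip^~ h) ode_eq.
      by rewrite /inertial_force !ipE (ip0l ip); lra.
    have -> := increment_split z r (v z) (v r) (g z) (g r) (hl_derive t0 v r)
      (hl_derive t0 g r) (inertial_force t).
    rewrite -forceE.
    rewrite (le_trans (ler_normD _ _))//.
    have n1 := ler_normD (v z - v r - (z - r) *: hl_derive t0 v r)
      (beta *: (g z - g r - (z - r) *: hl_derive t0 g r)).
    rewrite normrZ gtr0_norm// in n1.
    have n2 := ler_wpM2l (ltW beta_gt0) h2.
    have n3 := ler_wpM2r (normr_ge0 (z - r)) fr.
    rewrite normrZ.
    have n4 : e1 * (1 + beta) * `|z - r| = e' * `|z - r| by rewrite /e1 divfK// gt_eqF.
    lra.
  - exists 1 => // r rpq.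
    have t0r : t0 <= r by case/andP: rpq => pr _; exact: le_trans pr.
    have [K K0 [d1 d10 h1]] := grad_along_lipschitz t0r.
    exists (beta * K + `|inertial_force t|), d1 => // z /andP[pz zq] zr.
    have {}h1 := h1 z (le_trans t0p pz) zr.
    have -> := increment_split0 z r (v z) (v r) (g z) (g r) (inertial_force t).
    have n1 := ler_normD (v z - v r) (beta *: (g z - g r) - (z - r) *: inertial_force t).
    have n2 := ler_normB (beta *: (g z - g r)) ((z - r) *: inertial_force t).
    rewrite !normrZ (gtr0_norm beta_gt0) in n2.
    have n3 := ler_wpM2l (ltW beta_gt0) h1.
    lra.
have -> := increment_split1 s t (v s) (v t) (g s) (g t) (inertial_force t).
rewrite -/(w s) -/(w t) -/(u s) -/(u t).
move: sd; rewrite /ball/= => sd.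
have [st|st] := leP s t.
- rewrite distrC (distrC s) (ger0_norm (_ : 0 <= t - s)) ?subr_ge0//.
  apply: mv => // r /andP[sr rt].
  rewrite /ball/= ger0_norm ?subr_ge0//; rewrite ger0_norm ?subr_ge0// in sd; lra.
- rewrite (gtr0_norm (_ : 0 < s - t)) ?subr_gt0//; apply: mv => [|r /andP[tr rs]]; first exact: ltW.
  rewrite /ball/= ler0_norm ?subr_le0//; rewrite ler0_norm ?subr_le0// in sd; last exact: ltW.
  lra.
Unshelve. all: by end_near. Qed.

End velocity.

End trajectory_regularity.

(** * Energies and their dissipation *)

Section energy.
Variables (R : realType) (H : normedModType R) (ip : {dot H for idfun}).
Hypothesis hip : induces_norm ip.
Variables (alpha beta : R) (b eps f db deps dlam : R -> R).
Variables (x v g : R -> H) (xs : H).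
Variable t : R.
Hypothesis t_gt0 : 0 < t.
Hypothesis b_der : is_derive t 1 b (db t).
Hypothesis eps_der : is_derive t 1 eps (deps t).
Hypothesis x_der : is_derive t 1 x (v t).
Hypothesis f_der : is_derive t 1 f (ip (g t) (v t) - dlam t / 2 * `|g t| ^+ 2).
Hypothesis velocity_der : is_derive t 1 (fun s => v s + beta *: g s)
  (- ((alpha / t) *: v t + b t *: g t + eps t *: x t)).

(** Multiplying w = v + beta g by t cancels the friction alpha/t in the
    derivative: it involves x, v and g but no derivative of v or g. *)
Definition anchored q s := q *: (x s - xs) + s *: (v s + beta *: g s).

Let danchored_eq q : q *: v t + ((1 : R) *: (v t + beta *: g t) +
    t *: - ((alpha / t) *: v t + b t *: g t + eps t *: x t)) =
  (q + 1 - alpha) *: v t - (t * b t - beta) *: g t - (t * eps t) *: x t.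
Proof.
apply: (ip_ext hip) => h; rewrite !ipE.
move: (ip (v t) h) (ip (g t) h) (ip (x t) h) => ? ? ?.
by field; rewrite gt_eqF.
Qed.

Lemma is_derive_anchored q : is_derive t 1 (anchored q)
  ((q + 1 - alpha) *: v t - (t * b t - beta) *: g t - (t * eps t) *: x t).
Proof.
have d1 := is_derive_scale (is_derive_id t 1) velocity_der.
have d2 := is_deriveZ q (is_deriveB x_der (is_derive_cst xs t 1)).
have := is_deriveD d2 d1; rewrite subr0.
by move/is_derive_eq; apply; exact: danchored_eq.
Qed.

Definition energy q c s := s * (s * b s - beta) * f s
  + s ^+ 2 * eps s / 2 * (ip (x s) (x s) - c)
  + ip (anchored q s) (anchored q s) / 2.

Definition denergy q c := (2 * t * b t + t ^+ 2 * db t - beta) * f t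
  + t * (t * b t - beta) * (ip (g t) (v t) - dlam t / 2 * `|g t| ^+ 2)
  + (t * eps t + t ^+ 2 * deps t / 2) * (ip (x t) (x t) - c)
  + t ^+ 2 * eps t * ip (x t) (v t)
  + ip (anchored q t)
      ((q + 1 - alpha) *: v t - (t * b t - beta) *: g t - (t * eps t) *: x t).

Lemma is_derive_energy q c : is_derive t 1 (energy q c) (denergy q c).
Proof.
have did : is_derive t 1 (id : R -> R) 1 := is_derive_id t 1.
have dq := is_derive_anchored q.
set dV := (q + 1 - alpha) *: v t - _ - _ in dq.
have da := is_derive_ip hip dq dq.
have dx := is_derive_ip hip x_der x_der.
have cst_der (k : R) : is_derive t 1 (cst k) (0 : R) := is_derive_cst k t 1.
have d1 := is_deriveM (is_deriveM did (is_deriveB (is_deriveM did b_der) (cst_der beta))) f_der.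
have d2 := is_deriveM (is_deriveM (is_deriveM (is_deriveM did did) eps_der) (cst_der 2^-1))
  (is_deriveB dx (cst_der c)).
have d3 := is_deriveM da (cst_der 2^-1).
have := is_deriveD (is_deriveD d1 d2) d3.
set F := (X in is_derive t 1 X _).
have -> : F = energy q c by apply/funext => s; rewrite /F /energy !fctE /cst expr2.
move/is_derive_eq; apply.
rewrite !fctE /cst !scale_mul /denergy.
rewrite -/dV (ipC _ (v t) (x t)) (ipC _ dV).
move: (ip (anchored q t) dV) (ip (g t) (v t)) (ip (x t) (x t)) (ip (x t) (v t)) (`|g t|)
  => A B C D E.
by field.
Qed.


Hypothesis beta_gt0 : 0 < beta.
Hypothesis alpha_gt3 : 3 < alpha.
Hypothesis f_ge0 : 0 <= f t.
Hypothesis f_le : f t <= ip (g t) (x t - xs).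
Hypothesis dlam_ge0 : 0 <= dlam t.
Hypothesis eps_ge0 : 0 <= eps t.

Let ip_xy : ip (x t) (x t - xs) =
  (ip (x t) (x t) + ip (x t - xs) (x t - xs) - ip xs xs) / 2.
Proof. by rewrite !ipE (ipC _ xs (x t)); field. Qed.

Lemma denergyE : denergy (alpha - 1) 0 =
  - (alpha - 1) * (t * b t - beta) * ip (g t) (x t - xs)
  + (2 * t * b t + t ^+ 2 * db t - beta) * f t
  - t * (t * b t - beta) * (beta + dlam t / 2) * ip (g t) (g t)
  - (alpha - 1) * t * eps t * ip (x t) (x t - xs)
  + (t * eps t + t ^+ 2 * deps t / 2) * ip (x t) (x t)
  - beta * t ^+ 2 * eps t * ip (g t) (x t).
Proof.
rewrite /denergy /anchored hip !ipE (ipC _ (v t) (x t)) (ipC _ xs (x t)).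
rewrite (ipC _ (v t) (g t)) (ipC _ xs (g t)) (ipC _ (x t) (g t)).
by field.
Qed.

(** Convexity (f_le) absorbs the terms in f, and b - beta/t >= 1/2 those in |g|^2.
    The cross term beta t^2 eps <g, x> is split evenly; its |x|^2 part is of
    relative size t eps and is dominated by (alpha - 3)/2 t eps |x|^2 once t eps
    is small. *)
Lemma denergy_le : deps t <= 0 -> t / 2 <= t * b t - beta ->
  beta * (t * eps t) <= alpha - 3 ->
  0 <= (alpha - 3) * t * b t - t ^+ 2 * db t + beta * (2 - alpha) ->
  denergy (alpha - 1) 0 <= (alpha - 1) / 2 * (t * eps t) * ip xs xs.
Proof.
move=> deps0 Bt te hb; rewrite denergyE ip_xy.
have X0 := ip_ge0 hip (x t); have Y0 := ip_ge0 hip (x t - xs).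
have G0 := ip_ge0 hip (g t).
have := ip_ge0 hip (g t + eps t *: x t).
rewrite (_ : ip (g t + _) _ = ip (g t) (g t) + 2 * eps t * ip (g t) (x t)
   + eps t ^+ 2 * ip (x t) (x t)); last by rewrite !ipE (ipC _ (x t) (g t)); ring.
move: X0 Y0 G0 f_le.
move: (ip (x t) (x t)) (ip (x t - xs) _) (ip (g t) (g t)) (ip (g t) (x t)) (ip xs xs)
  (ip (g t) (x t - xs)) => X Y G gx XS gy X0 Y0 G0 fgy sq.
move: f_ge0 eps_ge0 dlam_ge0 deps0 Bt te hb fgy sq t_gt0 alpha_gt3 beta_gt0.
move: (f t) (eps t) (dlam t) (deps t) (b t) (db t) => F e l' e' B B'.
move=> F0 e0 l0 e0' Bt te hb fgy sq t0 a3 b0.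
have B0 : 0 <= t * B - beta by lra.
have p1 : 0 <= (alpha - 1) * (t * B - beta) * (gy - F).
  by rewrite mulr_ge0 ?subr_ge0// mulr_ge0//; lra.
have p2 : 0 <= ((alpha - 3) * t * B - t ^+ 2 * B' + beta * (2 - alpha)) * F by rewrite mulr_ge0.
have p3 : 0 <= t * (t * B - beta) * l' * G by rewrite !mulr_ge0// ltW.
have p4 : 0 <= (beta * t) * (t * B - beta - t / 2) * G.
  by rewrite mulr_ge0// mulr_ge0 ?subr_ge0// mulr_ge0// ltW.
have p5 : 0 <= (alpha - 1) * (t * e) * Y.
  by rewrite mulr_ge0// mulr_ge0//; [lra|rewrite mulr_ge0// ltW].
have p6 : 0 <= (beta * t ^+ 2) * (G + 2 * e * gx + e ^+ 2 * X).
  by rewrite mulr_ge0// mulr_ge0 ?exprn_ge0// ltW.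
have p7 : 0 <= (t * e) * (alpha - 3 - beta * (t * e)) * X.
  by rewrite mulr_ge0// mulr_ge0 ?subr_ge0// mulr_ge0// ltW.
have p8 : 0 <= t ^+ 2 * (- e') * X.
  by rewrite mulr_ge0// mulr_ge0 ?exprn_ge0 ?oppr_ge0// ltW.
lra.
Qed.

(** The left-hand side is t^(1 - k) times the derivative of t^k times the energy,
    with k = alpha/3 - 1. The choices of k and q = 2 (k + 1) cancel the products
    <x - xs, v> and <g, v>. *)
Lemma weighted_denergyE : (alpha / 3 - 1) * energy (2 * alpha / 3) (ip xs xs) t
    + t * denergy (2 * alpha / 3) (ip xs xs) =
  t * ((alpha / 3 - 1) * (t * b t - beta) + (2 * t * b t + t ^+ 2 * db t - beta)) * f t
  - t ^+ 2 * (t * b t - beta) * dlam t / 2 * ip (g t) (g t)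
  + ((alpha / 3 - 1) / 2 * t ^+ 2 * eps t + t ^+ 2 * eps t + t ^+ 3 * deps t / 2)
    * (ip (x t) (x t) - ip xs xs)
  + (alpha / 3 - 1) * (2 * alpha / 3) ^+ 2 / 2 * ip (x t - xs) (x t - xs)
  - (alpha / 3 - 1) / 2 * t ^+ 2 * ip (v t) (v t)
  + (2 * alpha / 3) * (alpha / 3 * beta - t * b t) * t * ip (g t) (x t - xs)
  + beta * ((alpha / 3 - 1) * beta / 2 + beta - t * b t) * t ^+ 2 * ip (g t) (g t)
  - t ^+ 2 * eps t * (2 * alpha / 3 * ip (x t) (x t - xs) + t * beta * ip (g t) (x t)).
Proof.
rewrite /energy /denergy /anchored hip !ipE (ipC _ (v t) (x t)) (ipC _ xs (x t)).
rewrite (ipC _ (v t) (g t)) (ipC _ xs (g t)) (ipC _ (x t) (g t)) (ipC _ xs (v t)).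
by field.
Qed.

(** The two remaining cross terms are handled by Young's inequality:
    t <g, y> <= |y|^2 + t^2 |g|^2 / 4 with y = x - xs, for the part of the
    coefficient that has the wrong sign, and
    - eps <g, x> <= |g|^2 + eps^2 |x|^2 / 4. Outside the ball the resulting
    eps^2 |x|^2 is compensated by eps', except for its part eps^2 |xs|^2. *)
Lemma weighted_denergy_le : ip xs xs <= ip (x t) (x t) ->
  2 * deps t <= - (beta * eps t ^+ 2) ->
  0 <= t * b t ->
  0 <= (alpha / 3 - 1) * t * b t - t ^+ 2 * db t + alpha * beta / 3 ->
  2 * alpha * (alpha - 3) - 9 * t ^+ 2 * eps t + 6 * alpha * beta <= 0 ->
  18 * beta * t + 9 * beta * dlam t - 9 * t * b t * (dlam t + 2 * beta)
      + 3 * (alpha + 3) * beta ^+ 2 + alpha ^+ 2 * beta <= 0 ->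
  (alpha / 3 - 1) * energy (2 * alpha / 3) (ip xs xs) t
    + t * denergy (2 * alpha / 3) (ip xs xs) <=
  beta / 4 * ip xs xs * (t ^+ 3 * eps t ^+ 2).
Proof.
move=> out he tb0 hb he3 hl; rewrite weighted_denergyE ip_xy.
have Y0 := ip_ge0 hip (x t - xs); have V0 := ip_ge0 hip (v t).
have G0 := ip_ge0 hip (g t).
have := ip_ge0 hip (2 *: g t + eps t *: x t).
rewrite (_ : ip (2 *: g t + _) _ = 4 * ip (g t) (g t) + 4 * eps t * ip (g t) (x t)
   + eps t ^+ 2 * ip (x t) (x t)); last by rewrite !ipE (ipC _ (x t) (g t)); ring.
have := ip_ge0 hip (t *: g t - 2 *: (x t - xs)).
rewrite (_ : ip (t *: g t - _) _ = t ^+ 2 * ip (g t) (g t) - 4 * t * ip (g t) (x t - xs)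
   + 4 * ip (x t - xs) (x t - xs)); last first.
  move: (x t - xs) => y; rewrite !ipE (ipC _ y (g t)); ring.
move: Y0 V0 G0 f_le out.
move: (ip (x t) (x t)) (ip (x t - xs) (x t - xs)) (ip (g t) (g t)) (ip (g t) (x t)) (ip xs xs)
  (ip (g t) (x t - xs)) (ip (v t) (v t)) => X Y G gx XS gy W Y0 W0 G0 fgy out sq1 sq2.
move: f_ge0 eps_ge0 he tb0 hb he3 hl fgy sq1 sq2 t_gt0 alpha_gt3 beta_gt0.
move: (f t) (eps t) (dlam t) (deps t) (b t) (db t) => F e l' e' B B'.
move=> F0 e0 he tb0 hb he3 hl fgy sq1 sq2 t0 a3 b0.
(* Each of the nonnegative products below is one of the terms to be discarded. *)
pose k := alpha / 3 - 1.
have k0 : 0 < k by rewrite /k; lra.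
have -> : alpha = 3 * (k + 1) by rewrite /k; field.
have aE : alpha = 3 * (k + 1) by rewrite /k; field.
rewrite aE in hb he3 hl.
have XX : 0 <= X - XS by lra.
have p1 : 0 <= (2 * (k + 1)) * (t * B) * t * (gy - F).
  by rewrite mulr_ge0 ?subr_ge0// mulr_ge0//; [rewrite mulr_ge0//; lra|exact: ltW].
have p2 : 0 <= t * (k * t * B - t ^+ 2 * B' + (k + 1) * beta) * F.
  by rewrite mulr_ge0// mulr_ge0//; lra.
have p3 : 0 <= (k + 1) ^+ 2 * beta * (t ^+ 2 * G - 4 * t * gy + 4 * Y).
  by rewrite mulr_ge0// mulr_ge0 ?exprn_ge0//; lra.
have p4 : 0 <= (k + 1) * (t ^+ 2 * e - 2 * k * (k + 1) - 2 * (k + 1) * beta) * Y.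
  by rewrite mulr_ge0// mulr_ge0//; lra.
have p5 : 0 <= (beta * t ^+ 3) * (4 * G + 4 * e * gx + e ^+ 2 * X).
  by rewrite mulr_ge0// mulr_ge0 ?exprn_ge0// ltW.
have p6 : 0 <= t ^+ 3 * (- (2 * e') - beta * e ^+ 2) * (X - XS).
  by rewrite mulr_ge0// mulr_ge0 ?exprn_ge0//; [exact: ltW|lra].
have p7 : 0 <= k * t ^+ 2 * e * (X - XS).
  by rewrite mulr_ge0// mulr_ge0// mulr_ge0 ?exprn_ge0// ltW.
have p8 : 0 <= k * t ^+ 2 * W.
  by rewrite mulr_ge0// mulr_ge0 ?exprn_ge0// ltW.
have p9 : 0 <= t ^+ 2 * G * - (18 * beta * t + 9 * beta * l' - 9 * t * B * (l' + 2 * beta) +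
     3 * (3 * (k + 1) + 3) * beta ^+ 2 + (3 * (k + 1)) ^+ 2 * beta).
  by rewrite mulr_ge0 ?oppr_ge0// mulr_ge0 ?exprn_ge0// ltW.
lra.
Qed.

End energy.

(** * Real functions near infinity *)

Section real_asymptotics.
Variable R : realType.
Local Notation mu := (@lebesgue_measure R).
Implicit Types (f F dF eps : R -> R) (t T p : R).

Lemma le0_is_derive_nincr F dF T t : T <= t ->
  (forall s, T <= s <= t -> is_derive s 1 F (dF s)) ->
  (forall s, T <= s <= t -> dF s <= 0) -> F t <= F T.
Proof.
move=> Tt hF dF0; have [||c] := @MVT_segment R F dF T t Tt.
- by move=> z; rewrite in_itv/= => /andP[/ltW Tz /ltW zt]; apply: hF; rewrite Tz.
- apply: derivable_within_continuous => z; rewrite in_itv/= => Tzt.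
  by have [] := hF z Tzt.
rewrite in_itv/= => Tct FE.
by rewrite -subr_le0 FE mulr_le0_ge0 ?dF0// subr_ge0.
Qed.

Lemma is_derive_Rintegral f t0 t : t0 < t ->
  {within [set` `[t0, +oo[], continuous f} ->
  is_derive t 1 (fun u => \int[mu]_(s in [set` `[t0, u]]) f s) (f t).
Proof.
move=> t0t fc.
have fint u : mu.-integrable [set` `[t0, u]] (EFin \o f).
  apply: continuous_compact_integrable; first exact: segment_compact.
  by apply: continuous_subspaceW fc; apply: subset_itvl.
have t1 : t < t + 1 by rewrite ltrDl.
have [d dE] := continuous_FTC1_closed t1 (fint _) t0t (continuous_within_half_line t0t fc).
by apply: DeriveDef; [exact: d|rewrite -dE derive1E].
Qed.

Lemma is_derive_powR p t : 0 < t -> is_derive t 1 (fun s => s `^ p) (p * t `^ (p - 1)).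
Proof.
move=> tp; have tI : t \in `]0, +oo[ by rewrite in_itv/= tp.
by apply: DeriveDef; [exact: derivable_powR|rewrite -derive1E powR_derive1].
Qed.

Lemma powR_pinfty p M : 0 < p -> \forall t \near +oo, M <= t `^ p.
Proof.
move=> p0; near=> t.
have M0 : 0 <= `|M| `^ p^-1 by exact: powR_ge0.
have tM : `|M| `^ p^-1 <= t by near: t; apply: nbhs_pinfty_ge; exact: num_real.
apply: (le_trans (ler_norm M)).
have -> : `|M| = (`|M| `^ p^-1) `^ p by rewrite -powRrM mulVf ?gt_eqF// powRr1.
by apply: ge0_ler_powR; rewrite ?nnegrE//; exact: ltW.
Unshelve. all: by end_near. Qed.

Lemma lipschitz_within_continuous t0 f :
  (forall t, t0 <= t -> pointwise_lipschitz t0 f t) ->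
  {within [set` `[t0, +oo[], continuous f}.
Proof.
move=> fL; apply/subspace_continuousP => t /=; rewrite in_itv/= andbT => t0t.
have [K K0 [d d0 fK]] := fL t t0t.
apply/cvgrPdist_le => e e0.
have K1 : 0 < K + 1 by rewrite ltr_wpDl.
have r0 : 0 < Num.min d (e / (K + 1)) by rewrite lt_min d0 divr_gt0.
apply: (filterS _ (near_dist t r0)) => s; rewrite lt_min => /andP[sd se] /=.
rewrite in_itv/= andbT => t0s; rewrite distrC (le_trans (fK s t0s sd))//.
rewrite ltr_pdivlMr// in se; have := normr_ge0 (s - t); lra.
Qed.

Lemma weighted_square_within_continuous t0 eps p : 0 < t0 ->
  (forall t, t0 <= t -> pointwise_lipschitz t0 eps t) ->
  {within [set` `[t0, +oo[], continuous (fun s => s `^ p * eps s ^+ 2)}.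
Proof.
move=> t00 /lipschitz_within_continuous/subspace_continuousP ec.
apply/subspace_continuousP => t ti.
have tp : 0 < t by move: ti; rewrite /= in_itv/= andbT; exact: lt_le_trans.
apply: cvgM.
  by apply: cvg_within_filter; exact: is_derive_continuous_at (is_derive_powR p tp).
by under eq_fun do rewrite expr2; rewrite expr2; apply: cvgM; exact: ec.
Qed.

End real_asymptotics.

(** * Decay of the Tikhonov coefficient *)

Section tikhonov_decay.
Variable R : realType.
Variables (t0 p beta : R) (eps : R -> R).
Hypothesis t0_gt0 : 0 < t0.
Hypothesis p_gt0 : 0 < p.
Hypothesis beta_gt0 : 0 < beta.
Hypothesis eps_gt0 : forall t, t0 <= t -> 0 < eps t.
Hypothesis eps_nincr : forall s t, t0 <= s -> s <= t -> eps t <= eps s.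
Hypothesis eps_lip : forall t, t0 <= t -> pointwise_lipschitz t0 eps t.

Definition weighted_square (t : R) : R :=
  \int[@lebesgue_measure R]_(s in [set` `[t0, t]]) (s `^ p * eps s ^+ 2).

Lemma weighted_square_ge0 t : 0 <= weighted_square t.
Proof. by apply: Rintegral_ge0 => s _; rewrite mulr_ge0 ?powR_ge0 ?sqr_ge0. Qed.

Lemma is_derive_weighted_square t : t0 < t ->
  is_derive t 1 weighted_square (t `^ p * eps t ^+ 2).
Proof.
move=> t0t; apply: (is_derive_Rintegral t0t).
exact: weighted_square_within_continuous.
Qed.

Hypothesis weighted_square_lim :
  beta / (t `^ p * eps t) * weighted_square t @[t --> +oo] --> 0.

(** On the interval from t/2 to t the integrand is at least (t/2)^p eps(t)^2. *)
Lemma weighted_square_ge t : 2 * t0 < t ->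
  t / 2 * (2^-1 `^ p * t `^ p * eps t ^+ 2) <= weighted_square t.
Proof.
move=> t02; have th : t0 < t / 2 by rewrite ltr_pdivlMr// mulrC.
have tp : 0 < t by move: t0_gt0; lra.
set K := 2^-1 `^ p * t `^ p * eps t ^+ 2.
have dF s : t / 2 <= s <= t ->
    is_derive s 1 (K \*: id - weighted_square) (K - s `^ p * eps s ^+ 2).
  move=> /andP[ts _]; have t0s := lt_le_trans th ts.
  have := is_deriveB (is_deriveZ K (is_derive_id s 1)) (is_derive_weighted_square t0s).
  by rewrite scale_mul mulr1.
have : (K \*: id - weighted_square) t <= (K \*: id - weighted_square) (t / 2).
  apply: (le0_is_derive_nincr _ dF); first by lra.
  move=> s /andP[ts st]; have t0s := ltW (lt_le_trans th ts).
  have s0 : 0 < s by exact: lt_le_trans t0s.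
  have A : 2^-1 `^ p * t `^ p <= s `^ p.
    rewrite -powRM; [|lra|lra].
    by apply: ge0_ler_powR; rewrite ?nnegrE; [exact: ltW|lra|lra|lra].
  have et := eps_gt0 (le_trans t0s st); have es := eps_nincr t0s st.
  have B : eps t ^+ 2 <= eps s ^+ 2 by rewrite ler_pXn2r ?nnegrE// ltW// eps_gt0.
  by rewrite subr_le0; apply: ler_pM => //; rewrite ?sqr_ge0// mulr_ge0// powR_ge0.
have := weighted_square_ge0 (t / 2).
rewrite !fctE /= !scale_mul => w0 h.
have : K * (t / 2) = K * t / 2 by rewrite mulrA.
lra.
Qed.

(** By [weighted_square_ge], the quantity that is assumed to vanish is at least a
    constant times t eps(t). *)
Lemma tikhonov_decay e : 0 < e -> \forall t \near +oo, t * eps t <= e.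
Proof.
move=> e0; pose c := 2^-1 `^ p / 2 * beta.
have c0 : 0 < c by rewrite mulr_gt0// divr_gt0// powR_gt0.
have ce0 : 0 < c * e by rewrite mulr_gt0.
have /cvgrPdist_le/(_ _ ce0) lim := weighted_square_lim.
near=> t.
have t02 : 2 * t0 < t by near: t; apply: nbhs_pinfty_gt; exact: num_real.
have : `|0 - beta / (t `^ p * eps t) * weighted_square t| <= c * e by near: t.
have t0t : t0 <= t by move: t0_gt0; lra.
have tp : 0 < t by exact: lt_le_trans t0t.
have et := eps_gt0 t0t; have tpp : 0 < t `^ p by exact: powR_gt0.
rewrite sub0r normrN ger0_norm; last first.
  by rewrite mulr_ge0 ?weighted_square_ge0// divr_ge0 ?mulr_ge0// ltW.
have q0 : 0 <= beta / (t `^ p * eps t) by rewrite divr_ge0 ?mulr_ge0// ltW.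
move=> /(le_trans (ler_wpM2l q0 (weighted_square_ge t02))).
have -> : beta / (t `^ p * eps t) * (t / 2 * (2^-1 `^ p * t `^ p * eps t ^+ 2)) = c * (t * eps t).
  by rewrite /c; field; rewrite !gt_eqF.
by rewrite ler_pM2l.
Unshelve. all: by end_near. Qed.

End tikhonov_decay.

(** * Lyapunov analysis *)

Section lyapunov_analysis.
Variables (R : realType) (H : normedModType R) (ip : {dot H for idfun}).
Hypothesis hip : induces_norm ip.
Variables (alpha beta t0 : R) (b eps f db deps dlam : R -> R).
Variables (x v g : R -> H) (xs : H).
Hypothesis t0_gt0 : 0 < t0.
Hypothesis beta_gt0 : 0 < beta.
Hypothesis alpha_gt3 : 3 < alpha.
Hypothesis b_der : forall t, t0 < t -> is_derive t 1 b (db t).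
Hypothesis eps_der : forall t, t0 < t -> is_derive t 1 eps (deps t).
Hypothesis x_der : forall t, t0 < t -> is_derive t 1 x (v t).
Hypothesis f_der : forall t, t0 < t ->
  is_derive t 1 f (ip (g t) (v t) - dlam t / 2 * `|g t| ^+ 2).
Hypothesis velocity_der : forall t, t0 < t ->
  is_derive t 1 (fun s => v s + beta *: g s)
    (- ((alpha / t) *: v t + b t *: g t + eps t *: x t)).
Hypothesis f_ge0 : forall t, t0 < t -> 0 <= f t.
Hypothesis f_le : forall t, t0 < t -> f t <= ip (g t) (x t - xs).
Hypothesis dlam_ge0 : forall t, t0 < t -> 0 <= dlam t.
Hypothesis b_ge : forall t, t0 < t -> t / 2 <= t * b t - beta.
Hypothesis eps_gt0 : forall t, t0 < t -> 0 < eps t.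
Hypothesis eps_deriv : forall t, t0 < t -> 2 * deps t <= - (beta * eps t ^+ 2).

Local Notation E := (energy ip beta b eps f x v g xs).

Lemma energy_ge q c t :
  t * (t * b t - beta) * f t + t ^+ 2 * eps t / 2 * (ip (x t) (x t) - c) <= E q c t.
Proof. by rewrite /energy lerDl divr_ge0// ip_ge0. Qed.

(** Once t eps(t) is small, the energy with q = alpha - 1 and c = 0 grows at most
    linearly, whereas it is at least t^2 f(t) / 2. *)
Lemma value_gap_vanishes :
  (forall t, t0 < t ->
    0 <= (alpha - 3) * t * b t - t ^+ 2 * db t + beta * (2 - alpha)) ->
  (forall e, 0 < e -> \forall t \near +oo, t * eps t <= e) ->
  forall e, 0 < e -> \forall t \near +oo, f t <= e.
Proof.
move=> hb decay e e0.
have [|T0 [_ hT0]] := decay ((alpha - 3) / beta); first by rewrite divr_gt0// subr_gt0.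
pose T := Num.max T0 t0 + 1.
have T0T : T0 < T by rewrite /T ltr_pwDr// le_max lexx.
have t0T : t0 < T by rewrite /T ltr_pwDr// le_max lexx orbT.
pose c := (alpha - 1) / 2 * ((alpha - 3) / beta) * ip xs xs.
have XS0 := ip_ge0 hip xs.
have c0 : 0 <= c.
  rewrite mulr_ge0// mulr_ge0//; first by move: alpha_gt3; lra.
  by rewrite divr_ge0 ?subr_ge0// ltW.
pose C := `|E (alpha - 1) 0 T| + c + 1.
have C0 : 0 < C by rewrite /C; have := normr_ge0 (E (alpha - 1) 0 T); lra.
near=> t.
have Tt : T <= t by near: t; apply: nbhs_pinfty_ge; exact: num_real.
have t1 : 1 <= t by near: t; apply: nbhs_pinfty_ge; exact: num_real.
have Ct : 2 * C / e <= t by near: t; apply: nbhs_pinfty_ge; exact: num_real.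
have t0t : t0 < t by exact: lt_le_trans Tt.
have dF s : T <= s <= t -> is_derive s 1 (E (alpha - 1) 0 - c \*: id)
    (denergy ip alpha beta b eps f db deps dlam x v g xs s (alpha - 1) 0 - c).
  move=> /andP[Ts _]; have t0s := lt_le_trans t0T Ts; have s0 := lt_trans t0_gt0 t0s.
  have := is_derive_energy hip xs s0 (b_der t0s) (eps_der t0s) (x_der t0s) (f_der t0s)
    (velocity_der t0s) (alpha - 1) 0.
  move/is_deriveB/(_ (is_deriveZ c (is_derive_id s 1))).
  by rewrite scale_mul mulr1.
have : (E (alpha - 1) 0 - c \*: id) t <= (E (alpha - 1) 0 - c \*: id) T.
  apply: (le0_is_derive_nincr Tt dF) => s /andP[Ts _].
  have t0s := lt_le_trans t0T Ts; have s0 := lt_trans t0_gt0 t0s.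
  have es := hT0 s (lt_le_trans T0T Ts).
  rewrite subr_le0; apply: le_trans.
    apply: denergy_le => //.
    - exact: f_ge0.
    - exact: f_le.
    - exact: dlam_ge0.
    - exact/ltW/eps_gt0.
    - have := eps_deriv t0s; have : 0 <= beta * eps s ^+ 2 by rewrite mulr_ge0 ?sqr_ge0// ltW.
      lra.
    - exact: b_ge.
    - by rewrite mulrC -ler_pdivlMr.
    - exact: hb.
  rewrite /c ler_wpM2r// ler_wpM2l//; move: alpha_gt3; lra.
rewrite !fctE /= !scale_mul => dec.
have := energy_ge (alpha - 1) 0 t; rewrite subr0 => lowE.
have X0 := ip_ge0 hip (x t).
have eX : 0 <= t ^+ 2 * eps t / 2 * ip (x t) (x t).
  by rewrite mulr_ge0// divr_ge0// mulr_ge0 ?sqr_ge0// ltW// eps_gt0.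
have tf : t * (t / 2) * f t <= t * (t * b t - beta) * f t.
  by rewrite ler_wpM2r ?f_ge0// ler_wpM2l ?b_ge//; lra.
have cT : 0 <= c * T by rewrite mulr_ge0// ltW// (lt_trans t0_gt0).
have nE := ler_norm (E (alpha - 1) 0 T).
have nE0 := normr_ge0 (E (alpha - 1) 0 T).
have Ct2 : C * t = (`|E (alpha - 1) 0 T| + 1) * t + c * t by rewrite /C; ring.
have h1 : `|E (alpha - 1) 0 T| <= `|E (alpha - 1) 0 T| * t by rewrite ler_peMr.
have h2 : t * (t / 2) * f t <= C * t by lra.
have tp : 0 < t by lra.
have h3 : t * f t <= 2 * C by rewrite -(ler_pM2l tp); lra.
rewrite ler_pdivrMr// in Ct.
by rewrite -(ler_pM2l tp); lra.
Unshelve. all: by end_near. Qed.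

Section outside_ball.
Variable T : R.
Hypothesis T_gt : t0 < T.
Hypothesis outside : forall t, T <= t -> ip xs xs <= ip (x t) (x t).
Hypothesis hb2 : forall t, t0 < t ->
  0 <= (alpha / 3 - 1) * t * b t - t ^+ 2 * db t + alpha * beta / 3.
Hypothesis heps3 : forall t, t0 < t ->
  2 * alpha * (alpha - 3) - 9 * t ^+ 2 * eps t + 6 * alpha * beta <= 0.
Hypothesis hlam : forall t, t0 < t ->
  18 * beta * t + 9 * beta * dlam t - 9 * t * b t * (dlam t + 2 * beta)
    + 3 * (alpha + 3) * beta ^+ 2 + alpha ^+ 2 * beta <= 0.
Variable J : R -> R.
Hypothesis J_ge0 : forall t, 0 <= J t.
Hypothesis J_der : forall t, t0 < t ->
  is_derive t 1 J (t `^ (alpha / 3 + 1) * eps t ^+ 2).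
Hypothesis J_lim : beta / (t `^ (alpha / 3 + 1) * eps t) * J t @[t --> +oo] --> 0.

Local Notation k := (alpha / 3 - 1).
Local Notation q := (2 * alpha / 3).
Local Notation XS := (ip xs xs).

Let k_gt0 : 0 < k. Proof. by move: alpha_gt3; lra. Qed.

Let powR_split t : 0 < t -> t `^ (alpha / 3 + 1) = t `^ k * t ^+ 2.
Proof.
move=> t0'; rewrite -powR_mulrn ?ltW// -powRD; first by congr (_ `^ _); lra.
by rewrite (gt_eqF t0') implybT.
Qed.

Lemma weighted_energy_bound t : T <= t ->
  t `^ k * E q XS t - beta / 4 * XS * J t <= T `^ k * E q XS T - beta / 4 * XS * J T.
Proof.
move=> Tt.
pose dF s := (s `^ k * denergy ip alpha beta b eps f db deps dlam x v g xs s q XS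
    + E q XS s * (k * s `^ (k - 1))) - beta / 4 * XS * (s `^ (alpha / 3 + 1) * eps s ^+ 2).
pose F := (fun s => s `^ k) * E q XS - (beta / 4 * XS) \*: J.
have FE s : F s = s `^ k * E q XS s - beta / 4 * XS * J s by [].
rewrite -!FE; apply: (@le0_is_derive_nincr _ F dF) => // s /andP[Ts _].
  have t0s := lt_le_trans T_gt Ts; have s0 := lt_trans t0_gt0 t0s.
  have dE := is_derive_energy hip xs s0 (b_der t0s) (eps_der t0s) (x_der t0s) (f_der t0s)
    (velocity_der t0s) q XS.
  exact: is_deriveB (is_deriveM (is_derive_powR k s0) dE) (is_deriveZ _ (J_der t0s)).
have t0s := lt_le_trans T_gt Ts; have s0 := lt_trans t0_gt0 t0s.
have sb : 0 <= s * b s by have := b_ge t0s; move: beta_gt0; lra.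
have := weighted_denergy_le hip v s0 beta_gt0 alpha_gt3 (f_ge0 t0s) (f_le t0s)
  (ltW (eps_gt0 t0s)) (outside Ts) (eps_deriv t0s) sb (hb2 t0s) (heps3 t0s) (hlam t0s).
have sk : s `^ k = s * s `^ (k - 1) by rewrite mulr_powRB1// ltW.
have sk0 : 0 <= s `^ (k - 1) by exact: powR_ge0.
move=> /(ler_wpM2l sk0); rewrite /dF powR_split// sk.
move: (denergy _ _ _ _ _ _ _ _ _ _ _ _ _ _ _ _) (energy _ _ _ _ _ _ _ _ _ _ _ _) => D E0.
by lra.
Qed.

(** The coefficient of |x|^2 - |xs|^2 in the weighted energy is P / 2, where
    P = t^(alpha/3 + 1) eps(t). It tends to infinity, since t^2 eps(t) is bounded
    below, and it dominates the integral J. *)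
Lemma limsup_norm_le e : 0 < e -> \forall t \near +oo, ip (x t) (x t) <= XS + e.
Proof.
move=> e0; pose C := `|T `^ k * E q XS T - beta / 4 * XS * J T|.
have XS0 := ip_ge0 hip xs.
pose c := 2 * alpha * (alpha - 3) / 9.
have c0 : 0 < c by rewrite divr_gt0// mulr_gt0 ?subr_gt0// mulr_gt0//; move: alpha_gt3; lra.
have e1 : 0 < e / (XS + 1) by rewrite divr_gt0//; lra.
have /cvgrPdist_le/(_ _ e1) lim := J_lim.
near=> t.
have Tt : T <= t by near: t; apply: nbhs_pinfty_ge; exact: num_real.
have t0t := lt_le_trans T_gt Tt; have tp := lt_trans t0_gt0 t0t.
have : `|0 - beta / (t `^ (alpha / 3 + 1) * eps t) * J t| <= e / (XS + 1) by near: t.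
have tk : 4 * C / (c * e) <= t `^ k by near: t; exact: powR_pinfty.
have ce : 0 < c * e by exact: mulr_gt0.
rewrite ler_pdivrMr// in tk.
have et := eps_gt0 t0t; have tkp : 0 < t `^ k by exact: powR_gt0.
have := weighted_energy_bound Tt; have := energy_ge q XS t.
rewrite powR_split//.
set P := t `^ k * t ^+ 2 * eps t.
have P0 : 0 < P by rewrite /P !mulr_gt0// exprn_gt0.
move=> low dec; rewrite sub0r normrN ger0_norm; last first.
  by rewrite mulr_ge0// divr_ge0// ltW.
rewrite mulrAC ler_pdivrMr// => lJ.
have tf : 0 <= t * (t * b t - beta) * f t.
  rewrite mulr_ge0 ?f_ge0// mulr_ge0 ?(ltW tp)//.
  by apply: le_trans (b_ge t0t); rewrite divr_ge0// ltW.
have h1 : t `^ k * (t ^+ 2 * eps t / 2 * (ip (x t) (x t) - XS)) <= t `^ k * E q XS t.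
  by rewrite ler_wpM2l// ?(ltW tkp)//; lra.
have h2 : P / 2 * (ip (x t) (x t) - XS) <= C + beta / 4 * XS * J t.
  rewrite (_ : P / 2 * _ = t `^ k * (t ^+ 2 * eps t / 2 * (ip (x t) (x t) - XS))); last first.
    by rewrite /P; field.
  by have := ler_norm (T `^ k * E q XS T - beta / 4 * XS * J T); rewrite -/C; lra.
have h3 : XS * (beta * J t) <= e * P.
  apply: (le_trans (ler_wpM2l XS0 lJ)).
  rewrite mulrA; apply: ler_wpM2r; first exact: ltW.
  rewrite mulrA ler_pdivrMr; last lra.
  by rewrite mulrC ler_pM2l//; lra.
have h4 : 4 * C <= e * P.
  apply: (le_trans tk).
  have ct : c <= t ^+ 2 * eps t.
    have := heps3 t0t; have : 0 <= 6 * alpha * beta.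
      by rewrite mulr_ge0 ?(ltW beta_gt0)// mulr_ge0//; move: alpha_gt3; lra.
    by rewrite /c; lra.
  by have := ler_wpM2l (ltW (mulr_gt0 tkp e0)) ct; rewrite /P; lra.
have : P / 2 * (ip (x t) (x t) - XS) <= P / 2 * e by lra.
by rewrite ler_pM2l ?divr_gt0// lerBlDr addrC.
Unshelve. all: by end_near. Qed.

End outside_ball.

End lyapunov_analysis.

(** * Strong convergence *)

Lemma hl_derive_ge0 (R : realType) (t0 t : R) (f : R -> R) : t0 <= t ->
  (forall r s, t0 <= r -> r <= s -> f r <= f s) -> hl_derivable t0 f t ->
  0 <= hl_derive t0 f t.
Proof.
move=> t0t fmono ft; apply/ler_addgt0Pl => e e0; rewrite addrC.
have [d d0 fd] := hl_derivable_linear_approx ft e0.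
have s0 : 0 < d / 2 by lra.
have := fd (t + d / 2); rewrite addrAC subrr add0r (gtr0_norm s0) scale_mul.
move=> /(_ ltac:(lra) ltac:(lra)); rewrite ler_norml => /andP[_ h].
have := fmono t (t + d / 2) t0t ltac:(lra) => h2.
by rewrite -(ler_pM2l s0); lra.
Qed.

Lemma limf_einf_eq0 (R : realType) (f : R -> R) (F : set_system R) : Filter F ->
  (forall t, 0 <= f t) ->
  (forall e V, 0 < e -> F V -> exists2 t, V t & f t <= e) ->
  limf_einf (fun t => (f t)%:E) F = 0%E.
Proof.
move=> FF f0 fe; rewrite /limf_einf; apply/eqP; rewrite oppe_eq0 eq_le.
apply/andP; split.
  apply: ge_ereal_inf; exists (ereal_sup ((\- (fun t => (f t)%:E))%E @` setT)).
    by exists setT => //; exact: filterT.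
  by apply: ge_ereal_sup => _ [t _ <-]; rewrite /= lee_fin oppr_le0.
apply: le_ereal_inf_tmp => _ [V FV <-]; apply/lee_addgt0Pr => e e0.
have [t Vt ft] := fe e V e0 FV.
apply: (@le_trans _ _ ((- f t)%:E + e%:E)%E).
  by rewrite -EFinD lee_fin; lra.
by apply: leeD => //; apply: ereal_sup_ubound; exists t.
Qed.

Section convergence.
Variables (R : realType) (H : completeNormedModType R) (ip : {dot H for idfun}).
Hypothesis hip : induces_norm ip.
Variable Phi : H -> \bar R.
Variables (m : R) (z : H).
Hypothesis Phi_ge : forall y, (m%:E <= Phi y)%E.
Hypothesis Phi_z : Phi z = m%:E.
Hypothesis selection : forall e, 0 < e -> exists2 d, 0 < d & forall y s,
  Phi y = s%:E -> s <= m + d -> `|y| <= `|z| + d -> `|y - z| < e.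

(** The last clause provides the proximal point p, at which Phi itself is
    controlled; at x the value of Phi may be infinite. *)
Lemma envelope_gap lam x g v : 0 < lam -> is_envelope ip Phi lam x g v ->
  [/\ 0 <= v - m, v - m <= ip g (x - z) &
    exists p s, [/\ Phi p = s%:E, s <= m + (v - m) & `|x - p| ^+ 2 <= 2 * lam * (v - m)]].
Proof.
move=> lam0 [r [pr -> sub]].
have mr : m <= r by have := Phi_ge (x - lam *: g); rewrite pr lee_fin.
have n0 : 0 <= lam / 2 * `|g| ^+ 2 by rewrite mulr_ge0 ?sqr_ge0// divr_ge0// ltW.
split.
- lra.
- have := sub _ _ Phi_z; have n1 : 0 <= lam * ip g g by rewrite mulr_ge0 ?(ip_ge0 hip)// ltW.
  by rewrite hip !ipE; lra.
- exists (x - lam *: g), r; split; [by []|lra|].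
  rewrite subKr normrZ exprMn real_normK ?num_real//.
  have : 0 <= 2 * lam * (r - m) by rewrite mulr_ge0 ?subr_ge0// mulr_ge0// ltW.
  lra.
Qed.

Variables (t0 L : R) (lam : R -> R) (x g : R -> H) (env : R -> R).
Hypothesis lam_gt0 : forall t, t0 <= t -> 0 < lam t.
Hypothesis lam_le : forall t, t0 <= t -> lam t <= L.
Hypothesis envelope_along : forall t, t0 <= t ->
  is_envelope ip Phi (lam t) (x t) (g t) (env t).
Hypothesis gap_vanishes : forall e, 0 < e -> \forall t \near +oo, env t - m <= e.

(** The proximal point p of x(t) has a value close to m and is close to x(t), the
    index lam being bounded by L; so [selection] applies to p. *)
Lemma eventually_close e : 0 < e -> exists2 d, 0 < d &
  \forall t \near +oo, `|x t| <= `|z| + d -> `|x t - z| < e.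
Proof.
move=> e0; have [|d0 d00 sel] := selection (e := e / 2); first by rewrite divr_gt0.
have L0 : 0 < L by apply: lt_le_trans (lam_le (lexx t0)); exact: lam_gt0.
pose d := d0 / 2; pose r := Num.min d (e / 2).
have r0 : 0 < r by rewrite lt_min /d !divr_gt0.
have rd : r <= d by rewrite ge_min lexx.
have re : r <= e / 2 by rewrite ge_min lexx orbT.
exists d; first by rewrite divr_gt0.
pose h := Num.min d0 (r ^+ 2 / (2 * L)).
have h0 : 0 < h by rewrite lt_min d00 divr_gt0 ?exprn_gt0 ?mulr_gt0.
have hd : h <= d0 by rewrite ge_min lexx.
have hL : h * (2 * L) <= r ^+ 2 by rewrite -ler_pdivlMr ?mulr_gt0// ge_min lexx orbT.
near=> t; move=> xt.
have t0t : t0 <= t by near: t; apply: nbhs_pinfty_ge; exact: num_real.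
have gap : env t - m <= h by near: t; exact: gap_vanishes.
have [g0 _ [p [s [ps sm xp]]]] := envelope_gap (lam_gt0 t0t) (envelope_along t0t).
have xpr : `|x t - p| <= r.
  rewrite -(@ler_pXn2r _ 2) ?nnegrE//; last exact: ltW.
  apply: (le_trans xp); apply: le_trans hL.
  have := lam_le t0t; have := lam_gt0 t0t => l0 lL.
  have A : lam t * (env t - m) <= L * h by apply: ler_pM => //; exact: ltW.
  lra.
have pz : `|p| <= `|z| + d0.
  have -> : p = x t - (x t - p) by rewrite subKr.
  by rewrite (le_trans (ler_normB _ _))//; move: xt rd; rewrite /d; lra.
have := sel p s ps ltac:(lra) pz.
have -> : x t - z = (x t - p) + (p - z) by rewrite addrA subrK.
by move=> h1; rewrite (le_lt_trans (ler_normD _ _))//; lra.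
Unshelve. all: by end_near. Qed.

Lemma cvg_of_limsup_norm :
  (forall e, 0 < e -> \forall t \near +oo, `|x t| <= `|z| + e) ->
  x t @[t --> +oo] --> z.
Proof.
move=> lsup; apply/cvgrPdist_lt => e e0; have [d d0 close] := eventually_close e0.
near=> t; rewrite distrC.
have xt : `|x t| <= `|z| + d by near: t; exact: lsup.
by move: xt; near: t.
Unshelve. all: by end_near. Qed.

End convergence.

(** * The convergence theorem *)

Theorem theorem7 (R : realType) (H : completeNormedModType R)
    (ip : {dot H for idfun}) (hip : induces_norm ip)
    (Phi : H -> \bar R)
    (Phi_proper : proper_function Phi)
    (Phi_convex : econvex Phi)
    (Phi_lsc : lower_semicontinuous Phi)
    (argmin_neq0 : argmin Phi !=set0)
    (alpha beta t0 : R)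
    (alpha_gt0 : 0 < alpha) (beta_gt0 : 0 < beta) (t0_gt0 : 0 < t0)
    (lam b eps : R -> R)
    (lam_gt0 : forall t, t0 <= t -> 0 < lam t)
    (lam_ndecr : forall s t, t0 <= s -> s <= t -> lam s <= lam t)
    (lam_diff : hl_differentiable t0 lam)
    (b_ge0 : forall t, t0 <= t -> 0 <= b t)
    (b_ndecr : forall s t, t0 <= s -> s <= t -> b s <= b t)
    (b_diff : hl_differentiable t0 b)
    (eps_ge0 : forall t, t0 <= t -> 0 <= eps t)
    (eps_C1 : hl_C1 t0 eps)
    (eps_nincr : forall s t, t0 <= s -> s <= t -> eps t <= eps s)
    (eps_lim : eps t @[t --> +oo] --> 0)
    (lam_bounded : [bounded lam t | t in [set` `[t0, +oo[]])
    (alpha_gt3 : 3 < alpha)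
    (b_t0 : 1 / 2 + beta / t0 <= b t0)
    (hb1 : forall t, t0 <= t ->
      0 <= (alpha - 3) * t * b t - t ^+ 2 * hl_derive t0 b t
           + beta * (2 - alpha))
    (heps1 : exists2 a : R, 1 <= a & forall t, t0 <= t ->
      2 * hl_derive t0 eps t <= - a * beta * eps t ^+ 2)
    (heps2 : (\int[@lebesgue_measure R]_(t in [set` `[t0, +oo[])
                (eps t / (t * b t))%R%:E < +oo)%E)
    (hb2 : forall t, t0 <= t ->
      0 <= (alpha / 3 - 1) * t * b t - t ^+ 2 * hl_derive t0 b t
           + alpha * beta / 3)
    (heps3 : forall t, t0 <= t ->
      2 * alpha * (alpha - 3) - 9 * t ^+ 2 * eps t + 6 * alpha * beta <= 0)
    (hlam : forall t, t0 <= t ->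
      18 * beta * t + 9 * beta * hl_derive t0 lam t
      - 9 * t * b t * (hl_derive t0 lam t + 2 * beta)
      + 3 * (alpha + 3) * beta ^+ 2 + alpha ^+ 2 * beta <= 0)
    (heps4 :
      beta / (t `^ (alpha / 3 + 1) * eps t)
      * (\int[@lebesgue_measure R]_(s in [set` `[t0, t]])
           (s `^ (alpha / 3 + 1) * eps s ^+ 2)) @[t --> +oo] --> 0)
    (x0 v0 : H) (x : R -> H)
    (hx : strong_global_solution ip Phi alpha beta t0 lam b eps x0 v0 x)
    (xs : H) (hxs : xs = metric_proj (argmin Phi) 0) :
  let inside := forall t, t0 <= t -> `|x t| < `|xs| in
  let outside := forall t, t0 <= t -> `|xs| <= `|x t| in
  (inside \/ outside -> x t @[t --> +oo] --> xs) /\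
  (~ (inside \/ outside) ->
    limf_einf (fun t : R => (`|x t - xs|%R)%:E) (pinfty_nbhs R) = 0%E).
Proof.
move=> inside outside.
have [c Phi_min_c] := argmin_neq0.
have [Phi_neNy [y0 Phi_y0]] := Phi_proper.
have [m Phi_c] : exists m, Phi c = m%:E.
  move: (Phi_min_c y0) (Phi_neNy c) Phi_y0.
  by case: (Phi c) => [r| |]// => [|h _ /eqP[]]; [exists r|apply/eqP; rewrite -leye_eq].
have Phi_ge y : (m%:E <= Phi y)%E by rewrite -Phi_c; exact: Phi_min_c.
have argminE y : argmin Phi y <-> Phi y = m%:E.
  split=> [ymin|ym y']; last by rewrite ym.
  by apply/eqP; rewrite eq_le Phi_ge andbT -Phi_c; exact: ymin.
have [z [Phi_z z_min sel]] := minimal_norm_minimizer hip Phi_convex Phi_lsc Phi_c Phi_ge.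
(* A minimizer of norm at most |z| is within every distance e of z. *)
have xsz : xs = z.
  have : is_metric_proj (argmin Phi) 0 xs.
    rewrite hxs; apply: (@xgetPex _ 0 [set p | is_metric_proj (argmin Phi) 0 p]); exists z.
    split; first exact/argminE.
    by move=> p /argminE/z_min; rewrite !sub0r !normrN.
  move=> [/argminE Phi_xs /(_ z)]; rewrite !sub0r !normrN => /(_ (proj2 (argminE z) Phi_z)) xs_le.
  apply/eqP; rewrite -subr_eq0 -normr_le0; apply/ler_addgt0Pr => e e0.
  have [d d0 seld] := sel e e0; rewrite add0r ltW//.
  by apply: (seld xs m) => //; [|apply: (le_trans xs_le)]; rewrite lerDl ltW.
rewrite {}xsz in inside outside *.
have [[x_diff v_cont] v_ac ode _ _] := hx.
have [eps_diff _] := eps_C1.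
pose v := hl_derive t0 x; pose g := grad_along ip Phi lam x.
pose env t := fine (moreau Phi (lam t) (x t)).
have envelope_along t : t0 <= t -> is_envelope ip Phi (lam t) (x t) (g t) (env t).
  move=> t0t; exact: (grad_moreau_envelope hip Phi_convex Phi_lsc Phi_c Phi_ge _ (lam_gt0 t t0t)).
have gap t (t0t : t0 <= t) := envelope_gap hip Phi_ge Phi_z (lam_gt0 t t0t) (envelope_along t t0t).
pose f t := env t - m.
have f_ge0 t : t0 < t -> 0 <= f t by move=> /ltW /gap[].
have f_le t : t0 < t -> f t <= ip (g t) (x t - z) by move=> /ltW /gap[].
have f_der t : t0 < t ->
    is_derive t 1 f (ip (g t) (v t) - hl_derive t0 lam t / 2 * `|g t| ^+ 2).
  move=> t0t; have := is_derive_envelope_along hip lam_gt0 lam_ndecr lam_diff x_diff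
    envelope_along t0t.
  by move/is_deriveB/(_ (is_derive_cst m t 1)); rewrite subr0.
have velocity_der t : t0 < t -> is_derive t 1 (fun s => v s + beta *: g s)
    (- ((alpha / t) *: v t + b t *: g t + eps t *: x t)).
  exact: (is_derive_velocity hip lam_gt0 lam_ndecr lam_diff x_diff envelope_along beta_gt0
    t0_gt0 b_diff eps_diff v_cont v_ac ode).
have b_der t : t0 < t -> is_derive t 1 b (hl_derive t0 b t).
  by move=> t0t; apply: hl_derivable_is_derive => //; exact/b_diff/ltW.
have eps_der t : t0 < t -> is_derive t 1 eps (hl_derive t0 eps t).
  by move=> t0t; apply: hl_derivable_is_derive => //; exact/eps_diff/ltW.
have x_der t : t0 < t -> is_derive t 1 x (v t).
  by move=> t0t; apply: hl_derivable_is_derive => //; exact/x_diff/ltW.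
have dlam_ge0 t : t0 < t -> 0 <= hl_derive t0 lam t.
  by move=> /ltW t0t; apply: hl_derive_ge0 => //; exact: lam_diff.
have b_ge t : t0 < t -> t / 2 <= t * b t - beta.
  move=> t0t; have tp := lt_trans t0_gt0 t0t.
  have bt : 1 / 2 + beta / t0 <= b t := le_trans b_t0 (b_ndecr _ _ (lexx t0) (ltW t0t)).
  have := ler_wpM2l (ltW tp) bt.
  have : t0 * (beta / t0) <= t * (beta / t0) by rewrite ler_wpM2r ?divr_ge0 ?ltW.
  by rewrite (mulrC t0) divfK ?gt_eqF//; lra.
have eps_gt0 t : t0 <= t -> 0 < eps t.
  move=> t0t; have tp := lt_le_trans t0_gt0 t0t; have := heps3 t t0t.
  have : 0 < alpha * (alpha - 3) by rewrite mulr_gt0 ?subr_gt0.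
  have : 0 < alpha * beta by rewrite mulr_gt0.
  move=> h1 h2 h3; have : 0 < 9 * t ^+ 2 * eps t by lra.
  by rewrite pmulr_rgt0// mulr_gt0 ?exprn_gt0.
have eps_gt0' t : t0 < t -> 0 < eps t by move/ltW; exact: eps_gt0.
have eps_deriv t : t0 < t -> 2 * hl_derive t0 eps t <= - (beta * eps t ^+ 2).
  move=> /ltW t0t; have [a a1 ha] := heps1; apply: (le_trans (ha t t0t)).
  by rewrite !mulNr lerN2 -mulrA ler_peMl// mulr_ge0 ?sqr_ge0// ltW.
have eps_lip t : t0 <= t -> pointwise_lipschitz t0 eps t.
  by move=> t0t; apply: hl_derivable_lipschitz; exact: eps_diff.
have p_gt0 : 0 < alpha / 3 + 1 by lra.
have gap_vanishes : forall e, 0 < e -> \forall t \near +oo, env t - m <= e.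
  apply: (value_gap_vanishes hip t0_gt0 beta_gt0 alpha_gt3 b_der eps_der x_der f_der
    velocity_der f_ge0 f_le dlam_ge0 b_ge eps_gt0' eps_deriv).
    by move=> t /ltW; exact: hb1.
  exact: (tikhonov_decay t0_gt0 p_gt0 beta_gt0 eps_gt0 eps_nincr eps_lip heps4).
have [L lam_le] : exists L, forall t, t0 <= t -> lam t <= L.
  have [M [_ hM]] := lam_bounded; exists (M + 1) => t t0t.
  by apply: (le_trans (ler_norm _)); apply: hM; rewrite ?ltrDl//= in_itv/= t0t.
have close := eventually_close hip Phi_ge Phi_z sel lam_gt0 lam_le envelope_along gap_vanishes.
have limsup_cvg := cvg_of_limsup_norm hip Phi_ge Phi_z sel lam_gt0 lam_le envelope_along
  gap_vanishes.
have outside_cvg T : t0 < T -> (forall t, T <= t -> `|z| <= `|x t|) -> x t @[t --> +oo] --> z.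
  move=> T_gt out; apply: limsup_cvg => e e0.
  have e2 : 0 < e ^+ 2 by rewrite exprn_gt0.
  have out2 t : T <= t -> ip z z <= ip (x t) (x t).
    by move=> Tt; rewrite -!hip ler_pXn2r ?nnegrE// out.
  have := limsup_norm_le hip t0_gt0 beta_gt0 alpha_gt3 b_der eps_der x_der f_der
    velocity_der f_ge0 f_le b_ge eps_gt0' eps_deriv T_gt out2
    (fun t t0t => hb2 t (ltW t0t)) (fun t t0t => heps3 t (ltW t0t))
    (fun t t0t => hlam t (ltW t0t)) (weighted_square_ge0 t0 (alpha / 3 + 1) eps)
    (fun t t0t => is_derive_weighted_square (alpha / 3 + 1) t0_gt0 eps_lip t0t) heps4 e2.
  apply: filterS => t; rewrite -!hip => h.
  rewrite -(@ler_pXn2r _ 2) ?nnegrE//; last by rewrite addr_ge0// ltW.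
  by apply: (le_trans h); rewrite sqrrD lerD2r lerDl mulrn_wge0// mulr_ge0// ltW.
(* Inside the ball the norm bound is immediate; outside it comes from the second
   energy. *)
split.
  case=> [ins|out].
    apply: limsup_cvg => e e0; near=> t.
    have t0t : t0 <= t by near: t; apply: nbhs_pinfty_ge; exact: num_real.
    by rewrite ltW// (lt_le_trans (ins t t0t))// lerDl ltW.
  apply: (outside_cvg (t0 + 1)); first by rewrite ltrDl.
  by move=> t t1; apply: out; rewrite (le_trans _ t1)// lerDl.
move=> _; apply: limf_einf_eq0 => // e V e0 [M [_ MV]].
(* Either the trajectory is eventually outside the ball, and converges, or it
   visits the open ball at arbitrarily late times, when it is close to z. *)
have [[T [T_gt out]]|often] := pselect (exists T, t0 < T /\ forall t, T <= t -> `|z| <= `|x t|).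
  have /cvgrPdist_le/(_ e e0)[M' [_ hM']] := outside_cvg T T_gt out.
  exists (Num.max M M' + 1); first by apply: MV; rewrite ltr_pwDr// le_max lexx.
  by rewrite distrC; apply: hM'; rewrite ltr_pwDr// le_max lexx orbT.
have [d d0 [M' [_ hM']]] := close e e0.
pose T := Num.max t0 (Num.max M M') + 1.
have [t Tt xt] : exists2 t, T <= t & `|x t| < `|z|.
  apply: contrapT => no; apply: often; exists T; split.
    by rewrite ltr_pwDr// le_max lexx.
  move=> t Tt; rewrite leNgt; apply/negP => xt; apply: no; by exists t.
have T_gt : Num.max M M' < T by rewrite ltr_pwDr// le_max lexx orbT.
have MT : M < t.
  by apply: lt_le_trans Tt; apply: le_lt_trans T_gt; rewrite le_max lexx.
have MT' : M' < t.
  by apply: lt_le_trans Tt; apply: le_lt_trans T_gt; rewrite le_max lexx orbT.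
exists t; first exact: MV.
by rewrite ltW//; apply: hM' => //; rewrite (le_trans (ltW xt))// lerDl ltW.
Unshelve. all: by end_near. Qed.
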